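(* Let $X$ be a locally compact Hausdorff space, let $H$ be a separable Hilbert space, let $1\le p<\infty$, and let $T\in C_{\mathrm b}^{\mathrm{str}}(X,B(H))$. Then $T\in C_0(X,\mathcal L^p(H))$ if and only if $T\in \mathcal L^p(C_0(X,H))$.
   Context: $C_{\mathrm b}^{\mathrm{str}}(X,B(H))$ denotes the $C^*$-algebra of bounded maps $T\colon X\to B(H)$ that are $*$-strongly continuous (i.e. $x\mapsto T(x)h$ and $x\mapsto T(x)^*h$ are norm continuous for every $h\in H$), with pointwise operations and supremum norm. $C_0(X,H)$ is the Banach space of norm-continuous functions $X\to H$ vanishing at infinity, a Hilbert $C_0(X)$-module with $\langle v,w\rangle(x)=\langle v(x),w(x)\rangle_H$ (conjugate-linear in the first variable); its $C^*$-algebra of adjointable operators is identified with $C_{\mathrm b}^{\mathrm{str}}(X,B(H))$ acting pointwise, $(Th)(x)=T(x)h(x)$. For a Banach space $Y$, $f\colon X\to Y$ vanishes at infinity if $\{x:\|f(x)\|\ge\epsilon\}$ is compact for all $\epsilon>0$, and $C_0(X,Y)$ is the Banach space of continuous $f\colon X\to Y$ vanishing at infinity. $\mathcal L^p(H)$ is the usual Schatten class on $H$ with norm $\|R\|_p=(\operatorname{tr}|R|^p)^{1/p}$. $C_0(X,\mathcal L^p(H))$ is the space of maps that are continuous and vanish at infinity with respect to $\|\cdot\|_p$, regarded as a subspace of $C_{\mathrm b}^{\mathrm{str}}(X,B(H))$. $\mathcal L^p(C_0(X,H))$ is the set of $T\in C_{\mathrm b}^{\mathrm{str}}(X,B(H))$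 for which the function $X\to[0,\infty]$, $x\mapsto \operatorname{tr}|T(x)|^p$, is finite everywhere and lies in $C_0(X)$. *)

(* Defs.v *)
From HB Require Import structures.
From mathcomp Require Import all_boot all_order all_algebra complex.
From mathcomp Require Import all_classical all_reals all_analysis.

Set Implicit Arguments.
Unset Strict Implicit.
Unset Printing Implicit Defensive.

Import Order.TTheory GRing.Theory Num.Theory.
Import numFieldNormedType.Exports.

Local Open Scope classical_set_scope.
Local Open Scope complex_scope.
Local Open Scope ring_scope.

HB.mixin Record isHilbert (R : realType) H
    of CompleteNormedModule R[i] H := {
  hdot : {dot H for Num.conj} ;
  hdotE : forall v : H, hdot v v = `|v| ^+ 2
}.

#[short(type="hilbertType")]
HB.structure Definition Hilbert (R : realType) :=
  { H of CompleteNormedModule R[i] H & isHilbert R H }.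

Definition separable (Y : topologicalType) :=
  exists2 D : set Y, countable D & dense D.

Section operators.
Context {R : realType} {H : hilbertType R}.
Implicit Types (A B : H -> H) (E : set H) (p : R).

(* The forms [{dot U for theta}] are linear in their first argument, whereas
   [inner] is conjugate-linear in the first one. *)
Definition inner (v w : H) : R[i] := @hdot R H w v.

Definition op_bound A (M : R) :=
  0 <= M /\ forall h, `|A h| <= M%:C * `|h|.

(* B(H), as a set of functions *)
Definition bounded_op : set (H -> H) :=
  [set A | linear A /\ exists M, op_bound A M].

(* Meaningful for [A] in B(H) only: the infimum of an empty set is 0. *)
Definition opnorm A : R := inf [set M | op_bound A M].

(* Riesz: the set below is a singleton when [A] is in B(H). *)
Definition adjoint A : H -> H :=
  xget (cst 0) [set B | bounded_op B /\
                        forall u v, inner (A u) v = inner u (B v)].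

(* [0 <= z] in [R[i]] means that z is real and nonnegative. *)
Definition positive_op : set (H -> H) :=
  [set A | bounded_op A /\ forall h, 0 <= inner h (A h)].

(* |A|, the unique positive square root of A^* A *)
Definition absop A : H -> H :=
  xget (cst 0) [set B | positive_op B /\ B \o B = adjoint A \o A].

Definition poly_op (q : {poly R}) A : H -> H :=
  fun h => \sum_(i < size q) (q`_i)%:C *: iter i A h.

(* B = f(A) in the continuous functional calculus of a positive operator A:
   B is the norm limit of q_n(A) for real polynomials q_n converging to f
   uniformly on [0, ||A||], an interval that contains the spectrum of A. *)
Definition is_fun_calc (f : R -> R) A B :=
  bounded_op B /\
  forall eps : R, 0 < eps -> exists q : {poly R},
    (forall t, 0 <= t <= opnorm A -> `|q.[t] - f t| <= eps) /\
    opnorm (poly_op q A \- B) <= eps.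

(* A^p for a positive operator A and a real exponent p > 0 *)
Definition powop A p : H -> H :=
  xget (cst 0) [set B | is_fun_calc (fun t => t `^ p) A B].

Definition is_orthonormal_basis E :=
  (forall e f, E e -> E f -> inner e f = (e == f)%:R) /\
  (forall v, (forall e, E e -> inner e v = 0) -> v = 0).

(* Trace of a positive operator, computed in some orthonormal basis (it does
   not depend on which one). *)
Definition trace A : \bar R :=
  \esum_(e in xget set0 [set E | is_orthonormal_basis E])
    (complex.Re (inner e (A e)))%:E.

(* tr |A|^p *)
Definition trace_abs_pow p A : \bar R := trace (powop (absop A) p).

Definition schatten_norm p A : \bar R := poweR (trace_abs_pow p A) p^-1.

Definition schatten_class p : set (H -> H) :=
  [set A | bounded_op A /\ (trace_abs_pow p A < +oo)%E].

End operators.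

Section function_spaces.
Context {X : topologicalType} {R : realType}.

Definition C0 (Y : normedModType R) : set (X -> Y) :=
  [set f | continuous f /\
           forall eps : R, 0 < eps -> compact [set x : X | eps <= `|f x|]].

Context {H : hilbertType R}.

(* Bounded *-strongly continuous maps X -> B(H) *)
Definition Cb_str : set (X -> H -> H) :=
  [set T | [/\ forall x, bounded_op (T x),
               exists M : R, forall x, opnorm (T x) <= M,
               forall h, continuous (fun x => T x h) &
               forall h, continuous (fun x => adjoint (T x) h)]].

(* C_0(X, L^p(H)): continuity and vanishing at infinity are those of [C0], with
   the Schatten norm in place of [`|_|]. *)
Definition C0_schatten (p : R) : set (X -> H -> H) :=
  [set T | [/\ forall x : X, schatten_class p (T x),
               forall x : X, schatten_norm p (T y \- T x) @[y --> x] --> 0%E &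
               forall eps : R, 0 < eps ->
                 compact [set x : X | (eps%:E <= schatten_norm p (T x))%E]]].

(* L^p(C_0(X, H)) *)
Definition schatten_C0 (p : R) : set (X -> H -> H) :=
  [set T | [/\ Cb_str T,
               forall x : X, (trace_abs_pow p (T x) < +oo)%E &
               @C0 R (fun x : X => fine (trace_abs_pow p (T x)))]].

End function_spaces.

(* Main.v *)
(* The power [tr |A|^p] is the supremum of [sum_i |<f_i, A e_i>|^p] over finite
   Bessel systems [e] and [f], that is, families with
   [sum_i |<e_i, h>|^2 <= |h|^2] for all [h]. The sum is at most [tr |A|^p] by
   an approximate polar decomposition [A ~ W |A|], Cauchy-Schwarz for the form
   [<u, |A| v>], Jensen's inequality and Parseval's identity. Conversely, the
   compression of [|A|] to a finite-dimensional Krylov space is a hermitian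
   matrix; its eigenvectors [v_i] and the vectors [W v_i] are nearly optimal.
   The same compression shows that a polynomial which is nonnegative on
   [[0, ||B||]] gives a positive operator [q(B)], whence the functional calculus.

   This formula yields the triangle inequality, hence the continuity of
   [tr |T|^p] when [T] is continuous for the Schatten norm. For the converse
   (Gruemm's theorem) take [e], [f] nearly optimal for [T x]. They stay nearly
   optimal for [T y] with [y] near [x], and a Bessel system orthogonal to [e]
   can be added to [e]; so the compressions of [T x] and [T y] to the
   complements of [e] and [f] are small in Schatten norm, and *-strong
   convergence takes care of the finite-rank remainder. *)
Require Import Defs.
From mathcomp Require Import all_boot all_order all_algebra complex.
From mathcomp Require Import all_classical all_reals all_analysis.
From mathcomp Require Import ring lra.

Set Implicit Arguments.
Unset Strict Implicit.
Unset Printing Implicit Defensive.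

Import Order.TTheory GRing.Theory Num.Theory.
Import numFieldNormedType.Exports.

Local Open Scope classical_set_scope.
Local Open Scope complex_scope.
Local Open Scope ring_scope.
Local Open Scope sesquilinear_scope.

(** Near [x], strong continuity controls [T y] only on finitely many vectors, and limits are taken
    along neighbourhoods, where dominated convergence for sequences does not apply. Every quantity
    therefore has to be witnessed by finite families. The pairing formula achieves this: [|A|]
    depends on [A] nonlinearly, but each [<f_i, A e_i>] is linear in [A]. Bounds are kept on p-th
    powers and not on norms, because p-th powers add over disjoint families. If [e] and [f] account
    for all but [eps] of a total bound, whatever lives on the complements is at most [eps]. This
    covers [p = 1] as well as [p > 1]. [adjoint], [absop], [powop] and the basis in [trace] are
    chosen by [xget], so nothing is known about them until an object with the required properties
    has been built: by Riesz' theorem, by polynomial approximation, by Zorn's lemma. *)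

Section real_powers.
Context {R : realType}.
Implicit Types (a b p s x y t : R).

(** Young's inequality for [b] and [a ^ (p - 1)], with exponents [p] and [p / (p - 1)], becomes this
    tangent inequality after multiplication by [p]. The case [p = 1] is apart because its conjugate
    exponent is infinite. *)
Lemma powR_tangent p a b : 1 <= p -> 0 <= a -> 0 <= b ->
  a `^ p + p * a `^ (p - 1) * (b - a) <= b `^ p.
Proof.
move=> p1 a0 b0; have [->|pn1] := eqVneq p 1.
  by rewrite subrr powRr0 !powRr1// mulr1 mul1r; lra.
have {}p1 : 1 < p by rewrite lt_neqAle eq_sym pn1.
have p0 : 0 < p by apply: lt_trans p1.
have pm0 : 0 < p - 1 by rewrite subr_gt0.
have := @conjugate_powR R b (a `^ (p - 1)) p (p / (p - 1)) b0 (powR_ge0 _ _) p0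
  (divr_gt0 p0 pm0).
have -> : p^-1 + (p / (p - 1))^-1 = 1 by field; rewrite !gt_eqF.
move=> /(_ erefl).
have -> : (a `^ (p - 1)) `^ (p / (p - 1)) = a `^ p.
  by rewrite -powRrM mulrC divfK// gt_eqF.
rewrite -(ler_pM2l p0).
have -> : p * (b `^ p / p + a `^ p / (p / (p - 1))) = b `^ p + (p - 1) * a `^ p.
  by field; rewrite !gt_eqF.
have := @mulr_powRB1 R a p a0 p0.
set u := a `^ (p - 1); set v := a `^ p => e h.
by rewrite -!e in h *; nra.
Qed.

Lemma powR_lipschitz p K x y : 1 <= p -> 0 <= x <= K -> 0 <= y <= K ->
  `|x `^ p - y `^ p| <= p * K `^ (p - 1) * `|x - y|.
Proof.
move=> p1; have p0 : 0 <= p by apply: le_trans p1.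
have main a b : 0 <= a -> a <= b -> b <= K ->
    `|a `^ p - b `^ p| <= p * K `^ (p - 1) * `|a - b|.
  move=> a0 ab bK.
  have b0 : 0 <= b by apply: le_trans ab.
  have := @powR_tangent p b a p1 b0 a0.
  have : a `^ p <= b `^ p by rewrite ge0_ler_powR// nnegrE.
  have : b `^ (p - 1) <= K `^ (p - 1).
    by rewrite ge0_ler_powR ?nnegrE ?subr_ge0// (le_trans b0).
  set u := b `^ (p - 1); set v := K `^ (p - 1) => uv ab' h.
  rewrite !ler0_norm ?subr_le0// !opprB.
  have : p * u * (b - a) <= p * v * (b - a).
    by rewrite ler_wpM2r ?subr_ge0// ler_wpM2l.
  by nra.
move=> /andP[x0 xK] /andP[y0 yK]; case: (leP x y) => xy.
  exact: main.
by rewrite distrC (distrC x); apply: main => //; apply: ltW.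
Qed.

(** The two one-sided hypotheses are the form in which [schatten_norm_dist] delivers the closeness
    of two norms. *)
Lemma powR_continuity p a e : 1 <= p -> 0 <= a -> 0 < e -> exists2 d : R, 0 < d &
  forall b, 0 <= b -> a <= b + d -> b <= a + d -> `|a `^ p - b `^ p| <= e.
Proof.
move=> p1 a0 e0; have p0 : 0 <= p by apply: le_trans p1.
pose K := a + 1; pose L := p * K `^ (p - 1) + 1.
have L0 : 0 < L by rewrite ltr_wpDl// mulr_ge0 ?powR_ge0.
exists (Num.min 1 (e / L)) => [|b b0 ab ba]; first by rewrite lt_min ltr01 divr_gt0.
have aK : 0 <= a <= K by rewrite a0 lerDl ler01.
have bK : 0 <= b <= K.
  by rewrite b0/= (le_trans ba)// lerD2l ge_min lexx.
have abd : `|a - b| <= e / L.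
  have : Num.min 1 (e / L) <= e / L by rewrite ge_min lexx orbT.
  by rewrite ler_norml; set d := Num.min _ _ in ab ba * => ?; apply/andP; split; lra.
rewrite (le_trans (powR_lipschitz p1 aK bK))//.
apply: (@le_trans _ _ (L * (e / L))); last by rewrite mulrCA divff ?mulr1// gt_eqF.
by rewrite ler_pM ?mulr_ge0 ?powR_ge0// lerDl.
Qed.

(** Errors enter pairings additively, before the p-th power is taken. The cut-off at 0 keeps the
    base nonnegative, and a Lipschitz bound on a common interval [[0, K]] lets the error tend to 0
    in the finite sum. *)
Lemma le_sum_powR_limit (I : finType) (x : I -> R) p c : 1 <= p ->
  (forall i, 0 <= x i) ->
  (forall e : R, 0 < e -> \sum_i Num.max (x i - e) 0 `^ p <= c) ->
  \sum_i x i `^ p <= c.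
Proof.
move=> p1 x0 h.
pose K := \sum_i x i.
have xK i : x i <= K by rewrite /K (bigD1 i)//= lerDl sumr_ge0.
have K0 : 0 <= K by rewrite sumr_ge0.
have p0 : 0 <= p by apply: le_trans p1.
pose L := \sum_(i : I) p * K `^ (p - 1).
have L0 : 0 <= L by rewrite sumr_ge0// => i _; rewrite mulr_ge0// powR_ge0.
apply/ler_addgt0Pr => e e0.
pose d := e / (L + 1).
have d0 : 0 < d by rewrite divr_gt0// ltr_wpDl.
apply: (le_trans (y := \sum_i (Num.max (x i - d) 0 `^ p + p * K `^ (p - 1) * d))).
  apply: ler_sum => i _; rewrite -lerBlDl.
  have m0 : 0 <= Num.max (x i - d) 0 by rewrite le_max lexx orbT.
  have mx : Num.max (x i - d) 0 <= x i by rewrite ge_max x0 andbT; lra.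
  have mx' : x i - d <= Num.max (x i - d) 0 by rewrite le_max lexx.
  apply: (le_trans (ler_norm _)).
  apply: (le_trans (@powR_lipschitz p K _ _ p1 _ _)).
  - by rewrite x0 xK.
  - by rewrite m0 (le_trans mx).
  - rewrite ler_wpM2l ?mulr_ge0 ?powR_ge0// ger0_norm ?subr_ge0//; lra.
rewrite big_split/= lerD ?h// -mulr_suml -/L /d mulrCA ler_piMr// ?(ltW e0)//.
by rewrite ler_pdivrMr ?ltr_wpDl//; lra.
Qed.

End real_powers.

(** * Uniform approximation of [t ^ p] and of the square root by polynomials *)

Section weierstrass.
Context {R : realType}.
Implicit Types (f : R -> R) (g : nat -> R).

(* The Bernstein polynomial, whose value at [u] is the mean of [g] for the
   binomial law with parameters [n] and [u] *)
Fixpoint bernstein n g : {poly R} :=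
  if n is n'.+1 then
    'X * bernstein n' (g \o succn) + (1 - 'X) * bernstein n' g
  else (g 0%N)%:P.

Lemma le_bernstein n g1 g2 (u : R) : 0 <= u <= 1 ->
  (forall k, (k <= n)%N -> g1 k <= g2 k) ->
  (bernstein n g1).[u] <= (bernstein n g2).[u].
Proof.
move=> /andP[u0 u1]; elim: n g1 g2 => [|n ih] g1 g2 h /=.
  by rewrite !hornerC h.
rewrite !hornerE lerD// ler_wpM2l ?subr_ge0//; apply: ih => k kn.
  exact: h.
by apply: h; apply: leq_trans kn _.
Qed.

Lemma bernstein_linear n (a b : R) g1 g2 :
  bernstein n (fun k => a * g1 k + b * g2 k) =
  a *: bernstein n g1 + b *: bernstein n g2.
Proof.
elim: n g1 g2 => [|n ih] g1 g2 /=.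
  by rewrite -!mul_polyC -!polyCM -polyCD.
rewrite -[(fun k => _) \o succn]/(fun k =>
  a * (g1 \o succn) k + b * (g2 \o succn) k) !ih -!mul_polyC.
by ring.
Qed.

Lemma bernstein1 n : bernstein n (fun=> 1) = 1.
Proof.
elim: n => [//|n ih] /=.
by rewrite -[(fun=> 1) \o succn]/(fun _ : nat => 1) ih; ring.
Qed.

(** Variance [n u (1 - u)] plus squared bias. The centre [a] is free because the induction on [n]
    shifts it by one. *)
Lemma bernstein_variance n (a u : R) :
  (bernstein n (fun k => (k%:R - a) ^+ 2)).[u] =
  n%:R * u * (1 - u) + (n%:R * u - a) ^+ 2.
Proof.
elim: n a => [|n ih] a /=; first by rewrite hornerC; ring.
rewrite !hornerE ih.
have -> : (fun k => (k%:R - a) ^+ 2) \o succn = (fun k => (k%:R - (a - 1)) ^+ 2).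
  by apply/funext => k /=; rewrite -natr1; ring.
by rewrite ih -natr1; ring.
Qed.

(* The hypothesis is a form of uniform continuity suited to the variance
   estimate. *)
Lemma weierstrass (M : R) f : 0 < M ->
  (forall e : R, 0 < e -> exists2 C : R, 0 <= C & forall t x : R, 0 <= t <= M ->
    0 <= x <= M -> `|f t - f x| <= e + C * (t - x) ^+ 2) ->
  forall e : R, 0 < e -> exists q : {poly R},
    forall t : R, 0 <= t <= M -> `|q.[t] - f t| <= e.
Proof.
move=> M0 fc e e0.
have e20 : 0 < e / 2 by rewrite divr_gt0.
have [C C0 hC] := fc _ e20.
have [n n0 nC] : exists2 n : nat, 0 < n%:R :> R & C * M ^+ 2 / n%:R <= e / 2.
  exists (Num.truncn (C * M ^+ 2 / (e / 2))).+1; first by rewrite ltr0n.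
  rewrite ler_pdivrMr ?ltr0n// -ler_pdivrMl// mulrC.
  exact/ltW/truncnS_gt.
pose g k := f (M * (k%:R / n%:R)).
exists (bernstein n g \Po (M^-1 *: 'X)) => t /andP[t0 tM].
rewrite horner_comp !hornerE.
set u := M^-1 * t.
have u0 : 0 <= u by rewrite mulr_ge0// invr_ge0 ltW.
have u1 : u <= 1 by rewrite /u mulrC ler_pdivrMr ?mul1r.
have tu : t = M * u by rewrite /u mulrA divff ?mul1r// gt_eqF.
clearbody u.
have bound k : (k <= n)%N ->
    `|g k - f t| <= e / 2 + C * M ^+ 2 / n%:R ^+ 2 * (k%:R - n%:R * u) ^+ 2.
  move=> kn.
  have -> : C * M ^+ 2 / n%:R ^+ 2 * (k%:R - n%:R * u) ^+ 2
      = C * (M * (k%:R / n%:R) - t) ^+ 2.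
    by rewrite tu; field; rewrite gt_eqF.
  apply: hC; last by rewrite t0.
  rewrite mulr_ge0 ?divr_ge0 ?ler0n ?(ltW M0)//=.
  by rewrite ler_piMr ?(ltW M0)// ler_pdivrMr// mul1r ler_nat.
pose D := C * M ^+ 2 / n%:R ^+ 2.
have val : (bernstein n (fun k => (e / 2) * 1 + D * (k%:R - n%:R * u) ^+ 2)).[u]
    = e / 2 + C * M ^+ 2 / n%:R * (u * (1 - u)).
  rewrite bernstein_linear bernstein1 hornerD !hornerZ hornerC bernstein_variance /D.
  by field; rewrite gt_eqF.
have le_e : e / 2 + C * M ^+ 2 / n%:R * (u * (1 - u)) <= e.
  have : C * M ^+ 2 / n%:R * (u * (1 - u)) <= e / 2.
    apply: le_trans nC; rewrite ler_piMr//; last first.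
      by rewrite mulr_ile1 ?subr_ge0// lerBlDr lerDl.
    by rewrite divr_ge0 ?(ltW n0)// mulr_ge0// sqr_ge0.
  by lra.
have shift : (bernstein n (fun k => 1 * g k + (- f t) * 1)).[u]
    = (bernstein n g).[u] - f t.
  by rewrite bernstein_linear bernstein1 hornerD !hornerZ hornerC; ring.
rewrite -shift ler_norml; apply/andP; split; last first.
  apply: le_trans le_e; rewrite -val.
  apply: le_bernstein; first by rewrite u0.
  move=> k kn; rewrite mul1r !mulr1; apply: le_trans (bound k kn); exact: ler_norm.
rewrite lerNl; apply: le_trans le_e; rewrite -val.
have -> : - (bernstein n (fun k => 1 * g k + - f t * 1)).[u] =
    (bernstein n (fun k => (-1) * (1 * g k + - f t * 1) + 0 * 1)).[u].
  rewrite (bernstein_linear n (-1) 0 (fun k => 1 * g k + - f t * 1) (fun=> 1)).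
  by rewrite hornerD !hornerZ; ring.
apply: le_bernstein; first by rewrite u0.
move=> k kn; rewrite mul0r addr0 mul1r !mulr1 mulN1r.
by apply: le_trans (bound k kn); rewrite -normrN ler_norm.
Qed.

Lemma powR_poly_approx (M p e : R) : 1 <= p -> 0 < e ->
  exists q : {poly R}, forall t : R, 0 <= t <= M -> `|q.[t] - t `^ p| <= e.
Proof.
move=> p1 e0; have [M0|M0] := leP M 0.
  exists 0 => t /andP[t0 tM]; have -> : t = 0 by apply/le_anti; rewrite t0 (le_trans tM).
  by rewrite horner0 powR0 ?subrr ?normr0 ?ltW// gt_eqF// (lt_le_trans _ p1).
apply: weierstrass => // d d0.
pose L := p * M `^ (p - 1).
have L0 : 0 <= L by rewrite mulr_ge0 ?powR_ge0// (le_trans _ p1).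
(* From [L y <= d + L^2 y^2 / (4 d)]: the difference of the two sides is [(d - L y / 2)^2 / d]. *)
exists (L ^+ 2 / (4 * d)); first by rewrite divr_ge0 ?sqr_ge0// mulr_ge0// ltW.
move=> t x ht hx; apply: (le_trans (powR_lipschitz p1 ht hx)).
rewrite -/L -[(t - x) ^+ 2](real_normK (num_real _)).
set y := `|t - x|.
have -> : L ^+ 2 / (4 * d) * y ^+ 2 = (L * y) ^+ 2 / (4 * d) by rewrite mulrAC -exprMn.
rewrite -subr_ge0.
have -> : d + (L * y) ^+ 2 / (4 * d) - L * y = (d - L * y / 2) ^+ 2 / d.
  by field; rewrite gt_eqF.
by rewrite divr_ge0 ?sqr_ge0// ltW.
Qed.

Lemma sqrt_poly_approx (M e : R) : 0 < e ->
  exists q : {poly R}, forall t : R, 0 <= t <= M -> `|q.[t] - Num.sqrt t| <= e.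
Proof.
move=> e0; have [M0|M0] := leP M 0.
  exists 0 => t /andP[t0 tM]; have -> : t = 0 by apply/le_anti; rewrite t0 (le_trans tM).
  by rewrite horner0 sqrtr0 subrr normr0 ltW.
apply: weierstrass => // d d0.
(* Let [y] be the distance of the two roots, so that [y^2 <= |t - x|]. Either [y <= d], or
   [y <= y^4 / d^3 <= (t - x)^2 / d^3]. *)
exists (d ^- 3); first by rewrite invr_ge0 exprn_ge0// ltW.
move=> t x /andP[t0 _] /andP[x0 _]; set y := `|_|.
have y0 : 0 <= y by apply: normr_ge0.
have yt : y ^+ 2 <= `|t - x|.
  rewrite -{1}(sqr_sqrtr t0) -{1}(sqr_sqrtr x0) subr_sqr normrM expr2.
  rewrite ler_wpM2l// [leRHS]ger0_norm ?addr_ge0 ?sqrtr_ge0//.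
  rewrite /y (le_trans (ler_normB _ _))// !ger0_norm ?sqrtr_ge0//.
have [yd|dy] := leP y d.
  by rewrite (le_trans yd)// lerDl mulr_ge0 ?sqr_ge0// invr_ge0 exprn_ge0// ltW.
have : y <= d ^- 3 * (y ^+ 2) ^+ 2.
  rewrite mulrC ler_pdivlMr ?exprn_gt0// -exprM (exprS y 3) ler_wpM2l//.
  by rewrite lerXn2r ?nnegrE ?(ltW dy) ?(ltW d0).
have : d ^- 3 * (y ^+ 2) ^+ 2 <= d ^- 3 * (t - x) ^+ 2.
  rewrite ler_wpM2l ?invr_ge0 ?exprn_ge0 ?(ltW d0)//.
  by rewrite -[leRHS]ger0_norm ?sqr_ge0// normrX lerXn2r ?nnegrE ?sqr_ge0.
by lra.
Qed.

End weierstrass.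

(** * Real-valued norms and complex arithmetic *)

Section norms.
Context {R : realType}.

Lemma RtoC_inj (x y : R) : x%:C = y%:C -> x = y.
Proof. by case. Qed.

(** Norms over [R[i]] are complex numbers in a partial order. Their real part carries the same
    information and is accessible to real arithmetic. *)
Definition nr {V : normedZmodType R[i]} (v : V) : R := complex.Re `|v|.

Context {V : normedZmodType R[i]}.
Implicit Types (u v : V) (z w : R[i]).

Lemma nrE v : `|v| = (nr v)%:C.
Proof. by rewrite /nr RRe_real// ger0_real. Qed.

Lemma nr_ge0 v : 0 <= nr v.
Proof. by rewrite -ler0c -nrE. Qed.

Lemma nr_eq0 v : (nr v == 0) = (v == 0).
Proof. by rewrite -[v == 0]normr_eq0 nrE -(inj_eq (@complexI R)). Qed.

Lemma nr0 : nr (0 : V) = 0.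
Proof. by apply/eqP; rewrite nr_eq0. Qed.

Lemma nrN v : nr (- v) = nr v.
Proof. by rewrite /nr normrN. Qed.

Lemma ler_nrD u v : nr (u + v) <= nr u + nr v.
Proof. by rewrite -lecR rmorphD/= -!nrE; exact: ler_normD. Qed.

Lemma ler_nrB u v : nr (u - v) <= nr u + nr v.
Proof. by rewrite -[nr v]nrN ler_nrD. Qed.

Lemma nr_distC u v : nr (u - v) = nr (v - u).
Proof. by rewrite -nrN opprB. Qed.

Lemma ler_nr_sum (I : Type) (s : seq I) (F : I -> V) :
  nr (\sum_(i <- s) F i) <= \sum_(i <- s) nr (F i).
Proof.
elim/big_rec2 : _ => [|i x v _ h]; first by rewrite nr0.
by rewrite (le_trans (ler_nrD _ _))// lerD2l.
Qed.

Lemma eq_nr_le v : (forall e : R, 0 < e -> nr v <= e) -> v = 0.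
Proof.
move=> h; apply/eqP; rewrite -nr_eq0 eq_le nr_ge0 andbT.
by apply/ler_addgt0Pr => e e0; rewrite add0r h.
Qed.

End norms.

Section complex_numbers.
Context {R : realType}.
Implicit Types z w : R[i].

Lemma nrM z w : nr (z * w) = nr z * nr w.
Proof. by apply: RtoC_inj; rewrite rmorphM/= -!nrE normrM. Qed.

Lemma nr_real (a : R) : nr a%:C = `|a|.
Proof. by apply: RtoC_inj; rewrite -nrE normc_def/= expr0n addr0 sqrtr_sqr. Qed.

Lemma nr_conj z : nr z^* = nr z.
Proof. by rewrite /nr norm_conjC. Qed.

Lemma nr_sqr z : ((nr z) ^+ 2)%:C = z^* * z.
Proof. by rewrite rmorphXn/= -nrE normCK mulrC. Qed.

Lemma conjC_real (a : R) : (a%:C : R[i])^* = a%:C.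
Proof. exact: conjc_real. Qed.

Lemma ler_Re_nr z : `|complex.Re z| <= nr z.
Proof. by rewrite -lecR -nrE normc_ge_Re. Qed.

Lemma ReD z w : complex.Re (z + w) = complex.Re z + complex.Re w.
Proof. by case: z => ? ?; case: w. Qed.

Lemma ReN z : complex.Re (- z) = - complex.Re z.
Proof. by case: z. Qed.

Lemma Re_conj z : complex.Re z^* = complex.Re z.
Proof. by case: z. Qed.

Lemma ReZ (a : R) z : complex.Re (a%:C * z) = a * complex.Re z.
Proof. by case: z => x y /=; rewrite mul0r subr0. Qed.

Lemma Re_sum (I : Type) (s : seq I) (F : I -> R[i]) :
  complex.Re (\sum_(i <- s) F i) = \sum_(i <- s) complex.Re (F i).
Proof. by elim/big_rec2: _ => // i x y _ <-; rewrite ReD. Qed.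

End complex_numbers.

(** * Sesquilinearity and the Cauchy-Schwarz inequality *)

Section inner_product.
Context {R : realType} {H : hilbertType R}.
Implicit Types (u v w h : H) (a b : R[i]).

Lemma innerDr u v w : inner u (v + w) = inner u v + inner u w.
Proof. exact: linearDl. Qed.

Lemma innerZr a u v : inner u (a *: v) = a * inner u v.
Proof. exact: (linearZl_LR (@hdot R H)). Qed.

Lemma innerC u v : inner v u = (inner u v)^*.
Proof. by rewrite /inner (hermC (@hdot R H))/= expr0 mul1r. Qed.

Lemma innerDl u v w : inner (u + v) w = inner u w + inner v w.
Proof. by rewrite innerC innerDr rmorphD/= -!innerC. Qed.

Lemma innerZl a u v : inner (a *: u) v = a^* * inner u v.
Proof. by rewrite innerC innerZr rmorphM/= -!innerC. Qed.

Lemma inner0r u : inner u 0 = 0.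
Proof. by rewrite -(scale0r 0) innerZr mul0r. Qed.

Lemma inner0l u : inner 0 u = 0.
Proof. by rewrite innerC inner0r rmorph0. Qed.

Lemma innerNr u v : inner u (- v) = - inner u v.
Proof. by rewrite -scaleN1r innerZr mulN1r. Qed.

Lemma innerNl u v : inner (- u) v = - inner u v.
Proof. by rewrite innerC innerNr rmorphN/= -innerC. Qed.

Lemma innerBr u v w : inner u (v - w) = inner u v - inner u w.
Proof. by rewrite innerDr innerNr. Qed.

Lemma innerBl u v w : inner (u - v) w = inner u w - inner v w.
Proof. by rewrite innerDl innerNl. Qed.

Lemma inner_sumr (I : Type) (s : seq I) (F : I -> H) u :
  inner u (\sum_(i <- s) F i) = \sum_(i <- s) inner u (F i).
Proof. exact: (big_morph _ (innerDr u) (inner0r u)). Qed.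

Lemma inner_suml (I : Type) (s : seq I) (F : I -> H) u :
  inner (\sum_(i <- s) F i) u = \sum_(i <- s) inner (F i) u.
Proof. exact: (big_morph _ (fun v w => innerDl v w u) (inner0l u)). Qed.

Lemma inner_nr v : inner v v = ((nr v) ^+ 2)%:C.
Proof. by rewrite /inner hdotE nrE rmorphXn. Qed.

Lemma nr_innerC u v : nr (inner u v) = nr (inner v u).
Proof. by rewrite innerC nr_conj. Qed.

Lemma nrZ a v : nr (a *: v) = nr a * nr v.
Proof. by apply: RtoC_inj; rewrite rmorphM/= -!nrE normrZ. Qed.

Lemma nr_sqrD u v :
  nr (u + v) ^+ 2 = nr u ^+ 2 + nr v ^+ 2 + 2 * complex.Re (inner u v).
Proof.
have := inner_nr (u + v).
rewrite innerDl !innerDr !inner_nr (innerC u v) => /(congr1 (@complex.Re R)).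
by rewrite !ReD Re_conj /= => <-; ring.
Qed.

Lemma cauchy_schwarz u v : nr (inner u v) <= nr u * nr v.
Proof.
have [->|v0] := eqVneq v 0; first by rewrite inner0r !nr0 mulr0.
have := inner_nr (inner v v *: u - inner v u *: v).
rewrite !(innerBl, innerBr, innerZl, innerZr) -!innerC.
set a := inner v v; set b := inner v u.
have -> : inner u v = b^* by rewrite /b -innerC.
have -> : a * (a * inner u u - b * b^* ) - b^* * (a * b - b * a) =
    a * (a * inner u u - b * b^* ) by ring.
rewrite [b * _]mulrC -nr_sqr /a !inner_nr -!(rmorphM, rmorphB)/= => /RtoC_inj h.
have v20 : 0 < nr v ^+ 2 by rewrite exprn_gt0// lt_neqAle nr_ge0 andbT eq_sym nr_eq0.
rewrite nr_conj -(@ler_sqr _ (nr b)) ?nnegrE ?mulr_ge0 ?nr_ge0//.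
rewrite exprMn mulrC -subr_ge0 -(pmulr_rge0 _ v20) h sqr_ge0//.
Qed.

Lemma inner_inj u v : (forall w, inner w u = inner w v) -> u = v.
Proof.
move=> h; apply/eqP; rewrite -subr_eq0 -nr_eq0 -sqrf_eq0.
by rewrite -(inj_eq (@complexI R)) -inner_nr innerBr h subrr.
Qed.

Lemma complex_eq_real (z : R[i]) : z^* = z -> z = (complex.Re z)%:C.
Proof. by case: z => x y [] /eqP; rewrite eqNr => /eqP ->. Qed.

End inner_product.

(** * Completeness and orthogonal residuals *)

Section completeness.
Context {R : realType} {H : hilbertType R}.
Implicit Types (u v w h : H) (S : set H).

(** Completeness without a chosen sequence: [P e] is the set of approximations of quality [e], and
    these sets form the base of a Cauchy filter. It serves both minimising vectors and the
    functional calculus. *)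
Lemma approx_limit (P : R -> set H) :
  (forall e : R, 0 < e -> P e !=set0) ->
  (forall e d : R, e <= d -> P e `<=` P d) ->
  (forall e : R, 0 < e -> exists2 d : R, 0 < d &
     forall x y, P d x -> P d y -> nr (x - y) < e) ->
  exists w, forall e : R, 0 < e -> exists2 x, P e x & nr (w - x) < e.
Proof.
move=> P0 Pmono Pc.
pose F : set_system H := filter_from [set e : R | 0 < e] P.
have FF : ProperFilter F.
  apply: filter_from_proper; last by move=> e /= e0; exact: P0.
  apply: filter_from_filter; first by exists 1 => /=; rewrite ltr01.
  move=> d e /= d0 e0; exists (Num.min d e); first by rewrite /= lt_min d0.
  by move=> x Px; split; apply: Pmono Px; rewrite ge_min lexx ?orbT.
have /cauchy_cvg Fc : cauchy F.
  apply/cauchy_exP => e; rewrite ltcE/= => /andP[/eqP ei e0].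
  have [d d0 hd] := Pc _ e0; have [x Px] := P0 _ d0.
  exists x, d => // y Py; rewrite -ball_normE/= nrE ltcE/= ei eqxx/=.
  exact: hd.
exists (lim F) => e e0.
have FP : F (P e) by exists e.
have FB : F (ball (lim F) e%:C).
  by apply: Fc; apply: nbhsx_ballx; rewrite ltcR.
have [x [Px]] := filter_ex (filterI FP FB).
by rewrite -ball_normE/= nrE ltcR => hx; exists x.
Qed.

Definition subspace S :=
  [/\ S 0, forall u v, S u -> S v -> S (u + v) & forall a u, S u -> S (a *: u)].

(* Along a minimising sequence of the distance from [v] to [S], the residual
   is Cauchy by the parallelogram law. *)
Lemma residual_exists S v : subspace S -> exists w,
  (forall s, S s -> inner s w = 0) /\
  forall e : R, 0 < e -> exists2 s, S s & nr (v - s - w) < e.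
Proof.
move=> [S0 SD SZ].
pose Q : set R := [set nr (v - s) ^+ 2 | s in S].
have Q0 : has_inf Q.
  split; first by exists (nr (v - 0) ^+ 2), 0.
  by exists 0 => _ [s _ <-]; exact: sqr_ge0.
pose d := inf Q.
have dle s : S s -> d <= nr (v - s) ^+ 2.
  by move=> Ss; apply: ge_inf; [case: Q0|exists s].
pose P (e : R) : set H := [set x | S (v - x) /\ nr x ^+ 2 <= d + e].
have Pw e s : P e s -> forall t, S t -> d <= nr (s - t) ^+ 2.
  move=> [Ss _] t St; have -> : s - t = v - ((v - s) + t).
    by rewrite opprD opprB addrA addrCA subrr addr0.
  exact/dle/SD.
have [] := @approx_limit P.
- move=> e e0; have [_ [s Ss <-] hs] := inf_adherent e0 Q0.
  by exists (v - s); split; [rewrite opprB addrC subrK | exact/ltW].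
- by move=> e e' ee' x [Sx hx]; split=> //; rewrite (le_trans hx)// lerD2l.
(* With slack [s] in both squared norms, the parallelogram law gives [|x - y|^2 <= 4 s], here
   [e^2 / 2]. *)
- move=> e e0; exists (e ^+ 2 / 8); first by rewrite divr_gt0// exprn_gt0.
  move=> x y [Sx hx] [Sy hy].
  have Sxy : S (v - 2^-1 *: (x + y)).
    have -> : v - 2^-1 *: (x + y) = 2^-1 *: ((v - x) + (v - y)).
      rewrite addrACA -opprD scalerBr; congr (_ - _).
      by rewrite -mulr2n -(scaler_nat 2 v) scalerA mulVf ?scale1r// pnatr_eq0.
    exact/SZ/SD.
  have := dle _ Sxy; rewrite opprB addrC subrK nrZ exprMn.
  have -> : nr (2^-1 : R[i]) = 2^-1 :> R.
    have -> : (2^-1 : R[i]) = (2^-1 : R)%:C by rewrite fmorphV/= rmorphD.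
    by rewrite nr_real ger0_norm// invr_ge0.
  have := nr_sqrD x y; have := nr_sqrD x (- y).
  rewrite innerNr ReN nrN => h1 h2 h3.
  rewrite -(@ltr_pXn2r _ 2)// ?nnegrE ?nr_ge0 ?(ltW e0)//.
  rewrite h1; rewrite h2 in h3.
  have : 0 < e ^+ 2 by rewrite exprn_gt0.
  set E := e ^+ 2; rewrite -/E in hx hy; move: h3.
  set r := complex.Re _; set X := nr x ^+ 2; set Y := nr y ^+ 2.
  by rewrite -/X -/Y in hx hy *; lra.
move=> w hw; exists w; split; last first.
  move=> e e0; have [x [Sx _] hx] := hw _ e0; exists (v - x) => //.
  by rewrite opprB (addrC v) subrK -nrN opprB.
move=> s Ss; apply: eq_nr_le => e e0.
pose k := nr s + 1.
have k0 : 0 < k by rewrite ltr_wpDl// nr_ge0.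
(* The first bound makes [<s, w - x>] at most [e / 2], the second one does so for [<s, x>]. *)
pose f := Num.min (e / (2 * k)) ((e / (2 * k)) ^+ 2).
have ek0 : 0 < e / (2 * k) by rewrite divr_gt0// mulr_gt0.
have f0 : 0 < f by rewrite lt_min ek0 exprn_gt0.
have [x Px hx] := hw _ f0.
have wx : nr (inner s (w - x)) <= e / 2.
  apply: (le_trans (cauchy_schwarz _ _)).
  apply: (@le_trans _ _ (k * (e / (2 * k)))).
    apply: ler_pM; rewrite ?nr_ge0 ?lerDl//.
    by rewrite (ltW (lt_le_trans hx _))// ge_min lexx.
  by rewrite le_eqVlt; apply/orP; left; apply/eqP; field; rewrite gt_eqF.
suff sx : nr (inner s x) <= e / 2.
  rewrite -(subrK x w) innerDr (le_trans (ler_nrD _ _))//.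
  by rewrite (splitr e) lerD.
(* Moving [x] by [t <s, x> s] lowers [|x|^2] by at least [t |<s, x>|^2], because [t |s|^2 <= 1];
   near-minimality of [x] leaves room for at most [f]. *)
pose t := (k ^+ 2)^-1.
have k20 : 0 < k ^+ 2 by rewrite exprn_gt0.
have := Pw _ _ Px _ (SZ (t%:C * inner s x) _ Ss).
rewrite nr_sqrD innerNr innerZr nrN nrZ (innerC s x) -mulrA [_ * _^*]mulrC.
rewrite -nr_sqr -rmorphM ReN/= nrM nr_real ger0_norm ?invr_ge0 ?(ltW k20)//.
have [_] := Px; set c := nr (inner s x) => h1 h2.
have c0 : 0 <= c by exact: nr_ge0.
have {h1 h2} : t * c ^+ 2 <= f.
  have e1 : (t * c * nr s) ^+ 2 = (t * nr s ^+ 2) * (t * c ^+ 2) by ring.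
  have t1 : t * nr s ^+ 2 <= 1.
    rewrite mulrC ler_pdivrMr// mul1r lerXn2r ?nnegrE ?nr_ge0 ?(ltW k0)//.
    by rewrite lerDl.
  have t0 : 0 <= t * c ^+ 2 by rewrite mulr_ge0 ?sqr_ge0// invr_ge0 ltW.
  have := ler_piMl t0 t1; rewrite e1 in h2; lra.
rewrite mulrC ler_pdivrMr// => h.
rewrite -(@ler_pXn2r _ 2)// ?nnegrE ?divr_ge0 ?(ltW e0)//.
apply: (le_trans h); apply: (@le_trans _ _ ((e / (2 * k)) ^+ 2 * k ^+ 2)).
  by rewrite ler_wpM2r ?(ltW k20)// ge_min lexx orbT.
by rewrite le_eqVlt; apply/orP; left; apply/eqP; field; rewrite gt_eqF.
Qed.

End completeness.

(** * Bounded operators, Riesz representation, adjoints *)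

Section bounded_operators.
Context {R : realType} {H : hilbertType R}.
Implicit Types (A B : H -> H) (u v h : H) (M : R).

Lemma linear_fun0 A : linear A -> A 0 = 0.
Proof. by move=> /(_ (-1) 0 0); rewrite !scaleN1r !addNr. Qed.

Lemma linear_funD A u v : linear A -> A (u + v) = A u + A v.
Proof. by move=> /(_ 1 u v); rewrite !scale1r. Qed.

Lemma linear_funZ A a u : linear A -> A (a *: u) = a *: A u.
Proof. by move=> lA; have := lA a u 0; rewrite (linear_fun0 lA) !addr0. Qed.

Lemma linear_funB A u v : linear A -> A (u - v) = A u - A v.
Proof.
by move=> lA; rewrite (linear_funD _ _ lA) -scaleN1r (linear_funZ _ _ lA) scaleN1r.
Qed.

Lemma linear_fun_sum A (I : Type) (s : seq I) (F : I -> H) : linear A ->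
  A (\sum_(i <- s) F i) = \sum_(i <- s) A (F i).
Proof.
move=> lA; apply: (big_morph A _ (linear_fun0 lA)) => u v.
exact: linear_funD.
Qed.

Lemma op_boundP A M : op_bound A M <-> 0 <= M /\ forall h, nr (A h) <= M * nr h.
Proof.
split=> -[M0 h]; split=> // v.
  by have := h v; rewrite !nrE -rmorphM/= lecR.
by rewrite !nrE -rmorphM/= lecR.
Qed.

Lemma opnorm_le A M : op_bound A M -> opnorm A <= M.
Proof. by move=> h; apply: ge_inf => //; exists 0 => N []. Qed.

Lemma opnorm_ge0 A : 0 <= opnorm A.
Proof.
rewrite /opnorm; have [->|/set0P ne] := eqVneq [set M | op_bound A M] set0.
  by rewrite inf0.
by apply: lb_le_inf => // M [].
Qed.

Lemma opnormP A h : bounded_op A -> nr (A h) <= opnorm A * nr h.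
Proof.
move=> [_ bA]; have [h0|h0] := leP (nr h) 0.
  have [M /op_boundP[_ /(_ h)]] := bA.
  have -> : nr h = 0 by apply/le_anti; rewrite h0 nr_ge0.
  by rewrite !mulr0.
rewrite -ler_pdivrMr//; apply: lb_le_inf => // M /op_boundP[_ hM].
by rewrite ler_pdivrMr.
Qed.

Lemma bounded_op_lin A : bounded_op A -> linear A.
Proof. by case. Qed.

Lemma bounded_opI A M : linear A -> (forall h, nr (A h) <= M * nr h) ->
  bounded_op A /\ (0 <= M -> opnorm A <= M).
Proof.
move=> lA hM; have b : op_bound A (Num.max M 0).
  apply/op_boundP; split; first by rewrite le_max lexx orbT.
  by move=> h; rewrite (le_trans (hM h))// ler_wpM2r ?nr_ge0// le_max lexx.
split; first by split=> //; exists (Num.max M 0).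
by move=> M0; apply: opnorm_le; apply/op_boundP; split.
Qed.

Lemma bounded_opB A B : bounded_op A -> bounded_op B -> bounded_op (A \- B).
Proof.
move=> bA bB.
apply: (@bounded_opI _ (opnorm A + opnorm B) _ _).1.
  move=> a u v /=; rewrite (bounded_op_lin bA) (bounded_op_lin bB).
  by rewrite scalerBr opprD addrACA.
move=> h /=; rewrite mulrDl (le_trans (ler_nrB _ _))// lerD// opnormP//.
Qed.

Lemma bounded_op_comp A B : bounded_op A -> bounded_op B -> bounded_op (A \o B).
Proof.
move=> bA bB.
apply: (@bounded_opI _ (opnorm A * opnorm B) _ _).1.
  by move=> a u v /=; rewrite (bounded_op_lin bB) (bounded_op_lin bA).
move=> h /=; rewrite (le_trans (opnormP _ bA))// -mulrA ler_wpM2l ?opnorm_ge0//.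
exact: opnormP.
Qed.

(* The functional is determined by its kernel, and the residual of a vector
   outside the kernel represents it. *)
Lemma riesz (phi : H -> R[i]) M :
  (forall a u v, phi (a *: u + v) = a * phi u + phi v) ->
  (forall h, nr (phi h) <= M * nr h) ->
  exists u, forall h, phi h = inner u h.
Proof.
move=> lphi bphi.
have phi0 : phi 0 = 0.
  by have := lphi (-1) 0 0; rewrite scaleN1r mulN1r !addNr.
have phiD u v : phi (u + v) = phi u + phi v.
  by have := lphi 1 u v; rewrite scale1r mul1r.
have phiZ a u : phi (a *: u) = a * phi u.
  by have := lphi a u 0; rewrite !addr0 phi0 addr0.
have phiB u v : phi (u - v) = phi u - phi v.
  by rewrite phiD -scaleN1r phiZ mulN1r.
have [[v v0]|all0] := pselect (exists v, phi v != 0); last first.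
  exists 0 => h; rewrite inner0l; apply/eqP/negPn/negP => h0.
  by apply: all0; exists h.
have sK : subspace [set h | phi h = 0].
  split=> //= [u w|a u]; rewrite ?phiD ?phiZ => ->; last by rewrite mulr0.
  by move=> ->; rewrite addr0.
have [w [worth wapp]] := residual_exists v sK.
(* [v - w] is a limit of elements of the kernel, and [phi] is bounded. *)
have phiw : phi w = phi v.
  apply/eqP; rewrite eq_sym -subr_eq0; apply/eqP/eq_nr_le => e e0.
  have M0 : 0 < `|M| + 1 by rewrite ltr_wpDl.
  have [s /= s0 hs] := wapp _ (divr_gt0 e0 M0).
  have -> : phi v - phi w = phi (v - s - w) by rewrite !phiB s0 subr0.
  apply: (le_trans (bphi _)).
  apply: (@le_trans _ _ ((`|M| + 1) * nr (v - s - w))).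
    rewrite ler_wpM2r ?nr_ge0// (le_trans (ler_norm _))//.
    by rewrite lerDl.
  by rewrite mulrC -ler_pdivlMr// ltW.
have w0 : inner w w != 0.
  apply: contra v0 => /eqP; rewrite inner_nr => /RtoC_inj/eqP.
  by rewrite sqrf_eq0 nr_eq0 => /eqP w0; rewrite -phiw w0 phi0.
exists ((phi w / inner w w)^* *: w) => h.
rewrite innerZl conjCK.
have := worth (h - (phi h / phi v) *: w).
rewrite /= phiB phiZ phiw divfK// subrr => /(_ erefl).
rewrite innerC innerBr innerZr => /(congr1 Num.conj); rewrite conjCK rmorph0.
move=> /eqP; rewrite subr_eq0 => /eqP ->.
by rewrite mulrA mulrAC divfK// mulrC divfK.
Qed.

Lemma adjoint_spec A : bounded_op A ->
  bounded_op (adjoint A) /\ forall u v, inner (A u) v = inner u (adjoint A v).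
Proof.
move=> bA; have lA := bounded_op_lin bA.
suff [B] : exists B, bounded_op B /\ forall u v, inner (A u) v = inner u (B v).
  by move=> hB; rewrite /adjoint; case: xgetP => [? _ //|/(_ B)].
have /choice[B hB] : forall u, exists w, forall h, inner u (A h) = inner w h.
  move=> u; apply: (@riesz _ (nr u * opnorm A)).
    by move=> a v w; rewrite lA innerDr innerZr.
  move=> h; rewrite (le_trans (cauchy_schwarz _ _))// -mulrA.
  by rewrite ler_wpM2l ?nr_ge0// opnormP.
exists B; split; last by move=> u v; rewrite innerC hB -innerC.
apply: (@bounded_opI _ (opnorm A) _ _).1.
  move=> a u v; apply: inner_inj => w.
  apply: (can_inj (@conjCK _)); rewrite -!innerC -hB innerDl innerZl.
  by rewrite innerDl innerZl !hB.
move=> h; have [->|n0] := eqVneq (nr (B h)) 0.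
  by rewrite mulr_ge0 ?opnorm_ge0 ?nr_ge0.
have n1 : 0 < nr (B h) by rewrite lt_neqAle eq_sym n0 nr_ge0.
rewrite -(ler_pM2r n1) -expr2 -[leLHS]ger0_norm ?sqr_ge0//.
rewrite -nr_real -inner_nr -hB (le_trans (cauchy_schwarz _ _))//.
by rewrite mulrC mulrAC ler_wpM2r ?nr_ge0// opnormP.
Qed.

Lemma adjoint_unique A B : bounded_op A ->
  (forall u v, inner (A u) v = inner u (B v)) -> adjoint A = B.
Proof.
move=> /adjoint_spec[_ h] hB; apply/funext => v; apply: inner_inj => w.
by rewrite -h hB.
Qed.

Lemma inner_adjoint A u v : bounded_op A -> inner u (A v) = inner (adjoint A u) v.
Proof. by move=> /adjoint_spec[_ h]; rewrite innerC h -innerC. Qed.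

Lemma adjointB A B : bounded_op A -> bounded_op B ->
  adjoint (A \- B) = adjoint A \- adjoint B.
Proof.
move=> bA bB; apply: adjoint_unique; first exact: bounded_opB.
move=> u v /=; rewrite innerBl innerBr.
by have [_ ->] := adjoint_spec bA; have [_ ->] := adjoint_spec bB.
Qed.

End bounded_operators.

(** * Finite orthonormal families, orthonormal bases, Parseval's identity *)

Section orthonormal_families.
Context {R : realType} {H : hilbertType R}.
Implicit Types (u v h : H) (I : finType).

Definition orthofam I (v : I -> H) :=
  forall i j, inner (v i) (v j) = (i == j)%:R.

Definition bessel I (e : I -> H) :=
  forall h, \sum_i nr (inner (e i) h) ^+ 2 <= nr h ^+ 2.

(** The orthogonal projection on the span if [v] is orthonormal; [oproj v x = x] then expresses that
    [x] lies in the span. *)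
Definition oproj I (v : I -> H) h := \sum_i inner (v i) h *: v i.

Lemma inner_delta I (v : I -> H) (c : I -> R[i]) i : orthofam v ->
  inner (v i) (\sum_j c j *: v j) = c i.
Proof.
move=> ov; rewrite inner_sumr (bigD1 i)//= big1 => [|j ji].
  by rewrite innerZr ov eqxx mulr1 addr0.
by rewrite innerZr ov eq_sym (negbTE ji) mulr0.
Qed.

Lemma inner_oproj I (v : I -> H) h i : orthofam v ->
  inner (v i) (oproj v h) = inner (v i) h.
Proof. exact: inner_delta. Qed.

Lemma orthofam_nr I (v : I -> H) i : orthofam v -> nr (v i) = 1.
Proof.
move=> /(_ i i); rewrite eqxx inner_nr => /RtoC_inj/eqP.
by rewrite sqrf_eq1 => /orP[/eqP//|/eqP h]; have := nr_ge0 (v i); rewrite h; lra.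
Qed.

Lemma oproj_sum_inner I (v : I -> H) u w :
  inner (oproj v u) w = \sum_i (inner (v i) u)^* * inner (v i) w.
Proof. by rewrite inner_suml; apply: eq_bigr => i _; rewrite innerZl. Qed.

Lemma nr_sqr_oproj I (v : I -> H) h : orthofam v ->
  nr (oproj v h) ^+ 2 = \sum_i nr (inner (v i) h) ^+ 2.
Proof.
move=> ov; apply: RtoC_inj; rewrite -inner_nr oproj_sum_inner rmorph_sum/=.
by apply: eq_bigr => i _; rewrite inner_oproj// nr_sqr.
Qed.

Lemma nr_sqr_residual I (v : I -> H) h : orthofam v ->
  nr (h - oproj v h) ^+ 2 = nr h ^+ 2 - \sum_i nr (inner (v i) h) ^+ 2.
Proof.
move=> ov; rewrite nr_sqrD nrN -nr_sqr_oproj// innerNr ReN.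
have -> : complex.Re (inner h (oproj v h)) = nr (oproj v h) ^+ 2.
  rewrite innerC Re_conj oproj_sum_inner Re_sum nr_sqr_oproj//.
  by apply: eq_bigr => i _; rewrite -nr_sqr.
by ring.
Qed.

Lemma orthofam_bessel I (v : I -> H) : orthofam v -> bessel v.
Proof. by move=> ov h; rewrite -subr_ge0 -nr_sqr_residual// sqr_ge0. Qed.

Lemma inner_residual I (v : I -> H) h i : orthofam v ->
  inner (v i) (h - oproj v h) = 0.
Proof. by move=> ov; rewrite innerBr inner_oproj// subrr. Qed.

Lemma oproj_self_adjoint I (v : I -> H) u w :
  inner (oproj v u) w = inner u (oproj v w).
Proof.
rewrite oproj_sum_inner inner_sumr; apply: eq_bigr => i _.
by rewrite innerZr -innerC mulrC.
Qed.

Lemma oproj_linear I (v : I -> H) : linear (oproj v).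
Proof.
move=> a u w; rewrite /oproj scaler_sumr -big_split/=; apply: eq_bigr => i _.
by rewrite innerDr innerZr scalerDl scalerA.
Qed.

Lemma oprojB I (v : I -> H) u w : oproj v (u - w) = oproj v u - oproj v w.
Proof.
by rewrite /oproj -sumrB; apply: eq_bigr => i _; rewrite innerBr scalerBl.
Qed.

(** A vector that the family already recovers is skipped, whence the unknown length [m]. *)
Lemma gram_schmidt (s : seq H) : exists m (v : 'I_m -> H), orthofam v /\
  forall x, x \in s -> oproj v x = x.
Proof.
elim: s => [|x s [m [v [ov hv]]]].
  by exists 0%N, (fun=> 0); split=> // -[].
have [xv|nxv] := eqVneq (oproj v x) x.
  by exists m, v; split=> // y; rewrite inE => /orP[/eqP ->//|/hv].
pose r := x - oproj v x.
have r0 : nr r != 0 by rewrite nr_eq0 subr_eq0 eq_sym.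
pose a : R[i] := (nr r)^-1%:C.
pose w (i : 'I_m.+1) := if unlift ord0 i is Some j then v j else a *: r.
have w0 : w ord0 = a *: r by rewrite /w unlift_none.
have wS j : w (lift ord0 j) = v j by rewrite /w liftK.
have vr i : inner (v i) r = 0 by exact: inner_residual.
have rr : inner r r = (nr r ^+ 2)%:C by rewrite inner_nr.
have oprojw y : oproj w y = inner (a *: r) y *: (a *: r) + oproj v y.
  by rewrite /oproj big_ord_recl w0; congr (_ + _); apply: eq_bigr => j _; rewrite wS.
exists m.+1, w; split.
  move=> i j; case: (unliftP ord0 i) => [i' ->|->]; case: (unliftP ord0 j) => [j' ->|->].
  - by rewrite !wS ov (inj_eq lift_inj).
  - by rewrite w0 wS innerZr vr mulr0 eq_sym
      (negbTE (neq_lift _ _)).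
  - rewrite w0 wS innerC innerZr vr mulr0 rmorph0.
    by rewrite (negbTE (neq_lift _ _)).
  - rewrite w0 innerZl innerZr rr eqxx /a conjC_real -!rmorphM/=.
    by congr (_ %:C); field.
move=> y; rewrite inE oprojw => /orP[/eqP ->|ys].
  have -> : inner (a *: r) x = a * (nr r ^+ 2)%:C.
    rewrite innerZl conjC_real -rr; congr (_ * _).
    rewrite -[X in inner r X](subrK (oproj v x)) innerDr -/r.
    rewrite [X in _ + X](_ : _ = 0) ?addr0// inner_sumr big1// => i _.
    by rewrite innerZr [inner r _]innerC vr rmorph0 mulr0.
  rewrite scalerA -!rmorphM/=.
  have -> : (nr r)^-1 * nr r ^+ 2 * (nr r)^-1 = 1 by field.
  by rewrite scale1r subrK.
rewrite hv// innerZl (_ : inner r y = 0) ?mulr0 ?scale0r ?add0r//.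
rewrite -(hv _ ys) inner_sumr big1// => i _.
by rewrite innerZr [inner r _]innerC vr rmorph0 mulr0.
Qed.

Definition orthoset (E : set H) :=
  forall e f, E e -> E f -> inner e f = (e == f)%:R.

(** A nonzero vector orthogonal to a maximal orthonormal set could be normalised and added to it. *)
Lemma orthonormal_basis_exists : exists E : set H, is_orthonormal_basis E.
Proof.
have [|E [oE maxE]] := @Zorn_bigcup _ (orthoset : set (set H)).
  move=> F FO Ftot e f [X FX Xe] [Y FY Yf].
  have [XY|YX] := Ftot _ _ FX FY.
    by apply: (FO _ FY) => //; apply: XY.
  by apply: (FO _ FX) => //; apply: YX.
exists E; split=> // v Ev; apply/eqP/negPn/negP => v0.
have n0 : nr v != 0 by rewrite nr_eq0.
pose u := ((nr v)^-1)%:C *: v.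
have uu : inner u u = 1.
  rewrite innerZl innerZr inner_nr conjC_real -!rmorphM/=.
  have -> : (nr v)^-1 * ((nr v)^-1 * nr v ^+ 2) = 1 by field.
  by [].
have Eu e : E e -> inner e u = 0 by move=> Ee; rewrite innerZr Ev// mulr0.
have nEu : ~ E u by move=> /Eu/eqP; rewrite uu oner_eq0.
apply: (maxE (E `|` [set u])).
  split; first by move=> x Ex; left.
  by move=> h; apply: nEu; apply: h; right.
have ne e : E e -> e != u by move=> Ee; apply/eqP => eu; apply: nEu; rewrite -eu.
move=> e f [Ee|->] [Ef|->].
- exact: oE.
- by rewrite (negbTE (ne _ Ee)) Eu.
- by rewrite eq_sym (negbTE (ne _ Ef)) innerC Eu// rmorph0.
- by rewrite uu eqxx.
Qed.

Lemma orthoset_seq (E : set H) (l : seq H) : orthoset E -> uniq l ->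
  {in l, forall e, E e} -> orthofam (tnth (in_tuple l)).
Proof.
move=> oE ul lE i j; rewrite oE; first last.
- exact/lE/mem_tnth.
- exact/lE/mem_tnth.
by rewrite (inj_eq (tuple_uniqP _ _)).
Qed.

Lemma seq_oprojE (l : seq H) h :
  \sum_(e <- l) inner e h *: e = oproj (tnth (in_tuple l)) h.
Proof. exact: big_tnth. Qed.

(* The vectors that are recovered exactly from all sufficiently large finite
   parts of [E] form a subspace, and it is dense. *)
Lemma parseval_approx (E : set H) (x : H) (e : R) :
  is_orthonormal_basis E -> 0 < e -> exists l : seq H,
    {in l, forall f, E f} /\ forall l', {in l', forall f, E f} -> uniq l' ->
    {subset l <= l'} -> nr x ^+ 2 <= \sum_(f <- l') nr (inner f x) ^+ 2 + e.
Proof.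
move=> [oE cE] e0.
pose S : set H := [set s | exists2 l : seq H, {in l, forall f, E f} &
  forall l', {in l', forall f, E f} -> uniq l' -> {subset l <= l'} ->
  \sum_(f <- l') inner f s *: f = s].
have sS : subspace S.
  split=> [|u v [l lE hl] [k kE hk]|a u [l lE hl]].
  - by exists [::] => // l' _ _ _; rewrite big1// => f _; rewrite inner0r scale0r.
  - exists (l ++ k) => [f|l' l'E ul' sub].
      by rewrite mem_cat => /orP[/lE|/kE].
    have {}hl : \sum_(f <- l') inner f u *: f = u.
      by apply: hl => // f fl; apply: sub; rewrite mem_cat fl.
    have {}hk : \sum_(f <- l') inner f v *: f = v.
      by apply: hk => // f fl; apply: sub; rewrite mem_cat fl orbT.
    under eq_bigr do rewrite innerDr scalerDl.
    by rewrite big_split/= hl hk.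
  - exists l => // l' l'E ul' sub; rewrite -[in RHS](hl l' l'E ul' sub).
    rewrite scaler_sumr.
    by apply: eq_bigr => f _; rewrite innerZr scalerA.
have SE f : E f -> S f.
  move=> Ef; exists [:: f] => [g|l' l'E ul' sub]; first by rewrite inE => /eqP ->.
  have fl : f \in l' by apply: sub; rewrite inE.
  rewrite (bigD1_seq f)//= oE// eqxx scale1r big_seq_cond big1 ?addr0// => g.
  by move=> /andP[/l'E Eg gf]; rewrite oE// (negbTE gf) scale0r.
have [w [wS wapp]] := residual_exists x sS.
have w0 : w = 0 by apply: cE => f Ef; apply/wS/SE.
pose d := Num.min 1 e.
have d0 : 0 < d by rewrite lt_min ltr01.
have [s [l lE hl] hs] := wapp _ d0.
exists l; split=> // l' l'E ul' sub.
rewrite addrC -lerBlDr.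
have ov := orthoset_seq oE ul' l'E.
have -> : \sum_(f <- l') nr (inner f x) ^+ 2 =
    \sum_i nr (inner (tnth (in_tuple l') i) x) ^+ 2 by rewrite big_tnth.
rewrite -nr_sqr_residual//.
(* [l'] recovers [s] exactly, so [x] and [x - s] have the same residual, of norm at most
   [|x - s|]. *)
have -> : x - oproj (tnth (in_tuple l')) x =
    (x - s) - oproj (tnth (in_tuple l')) (x - s).
  by rewrite oprojB -[oproj _ s]seq_oprojE hl// opprB addrA subrK.
rewrite nr_sqr_residual//.
have : 0 <= \sum_i nr (inner (tnth (in_tuple l') i) (x - s)) ^+ 2.
  by rewrite sumr_ge0// => i _; rewrite sqr_ge0.
have : nr (x - s) ^+ 2 <= e.
  rewrite w0 subr0 in hs.
  apply: (@le_trans _ _ (d * 1)).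
    by rewrite expr2 ler_pM ?nr_ge0 ?(ltW hs)// (le_trans (ltW hs))// ge_min lexx.
  by rewrite mulr1 ge_min lexx orbT.
by lra.
Qed.

End orthonormal_families.

(** * Polynomials in a symmetric operator, reduced to hermitian matrices *)

Section polynomial_calculus.
Context {R : realType} {H : hilbertType R}.
Implicit Types (B : H -> H) (q r : {poly R}) (u v h : H).

Lemma linear_iter B k : linear B -> linear (iter k B).
Proof.
by move=> lB; elim: k => [//|k ih] a u v; rewrite !iterS ih lB.
Qed.

Lemma poly_op_widen n q B h : (size q <= n)%N ->
  poly_op q B h = \sum_(i < n) (q`_i)%:C *: iter i B h.
Proof.
move=> qn; rewrite /poly_op (big_ord_widen n (fun i => (q`_i)%:C *: iter i B h))//.
rewrite big_mkcond/=; apply: eq_bigr => i _; case: ltnP => // h'.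
by rewrite nth_default// scale0r.
Qed.

Lemma poly_op_linear q B : linear B -> linear (poly_op q B).
Proof.
move=> lB a u v; rewrite /poly_op scaler_sumr -big_split/=.
apply: eq_bigr => i _; rewrite (linear_iter _ lB) scalerDr !scalerA.
by rewrite [_ * a]mulrC.
Qed.

Lemma poly_opD q r B h : poly_op (q + r) B h = poly_op q B h + poly_op r B h.
Proof.
pose n := maxn (size q) (size r).
rewrite (@poly_op_widen n (q + r)) ?size_polyD//.
rewrite (@poly_op_widen n q) ?leq_maxl// (@poly_op_widen n r) ?leq_maxr//.
rewrite -big_split/=; apply: eq_bigr => i _.
by rewrite coefD rmorphD/= scalerDl.
Qed.

Lemma poly_opZ (a : R) q B h : poly_op (a *: q) B h = a%:C *: poly_op q B h.
Proof.
rewrite (@poly_op_widen (size q)) ?size_scale_leq// /poly_op scaler_sumr.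
by apply: eq_bigr => i _; rewrite coefZ rmorphM/= scalerA.
Qed.

Lemma poly_opB q r B h : poly_op (q - r) B h = poly_op q B h - poly_op r B h.
Proof. by rewrite poly_opD -scaleN1r poly_opZ rmorphN/= rmorph1 scaleN1r. Qed.

Lemma poly_opC (a : R) B h : poly_op a%:P B h = a%:C *: h.
Proof.
by rewrite (@poly_op_widen 1) ?size_polyC_leq1// big_ord1 coefC.
Qed.

Lemma poly_opXM q B h : linear B -> poly_op ('X * q) B h = B (poly_op q B h).
Proof.
move=> lB; rewrite (@poly_op_widen (size q).+1); last first.
  by rewrite (leq_trans (size_polyMleq _ _))// size_polyX.
rewrite big_ord_recl coefXM eqxx scale0r add0r /poly_op linear_fun_sum//.
apply: eq_bigr => i _; rewrite (linear_funZ _ _ lB) lift0 coefXM/=.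
by [].
Qed.

Lemma poly_opX B h : linear B -> poly_op 'X B h = B h.
Proof. by move=> lB; rewrite -['X]mulr1 poly_opXM// poly_opC scale1r. Qed.

Lemma poly_opM q r B h : linear B ->
  poly_op (q * r) B h = poly_op q B (poly_op r B h).
Proof.
move=> lB; elim/poly_ind: q h => [|q c ih] h.
  by rewrite mul0r -[0]/(0%:P) !poly_opC !scale0r.
rewrite mulrDl [q * 'X]mulrC -mulrA !poly_opD !poly_opXM// ih.
by rewrite mul_polyC poly_opZ poly_opC.
Qed.

Definition symmetric_op B := linear B /\ forall u v, inner (B u) v = inner u (B v).

Lemma poly_op_symmetric q B u v : symmetric_op B ->
  inner (poly_op q B u) v = inner u (poly_op q B v).
Proof.
move=> [lB sB]; have sI k a b : inner (iter k B a) b = inner a (iter k B b).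
  by elim: k a b => [//|k ih] a b; rewrite iterS sB ih -iterSr.
rewrite inner_suml inner_sumr; apply: eq_bigr => i _.
by rewrite innerZl innerZr conjC_real sI.
Qed.

(* Compress [B] to the span of the vectors [B^k e] and diagonalise the
   resulting hermitian matrix. *)
Lemma quadrature B (es : seq H) n : symmetric_op B ->
  exists m (v : 'I_m -> H) (t : 'I_m -> R),
  [/\ orthofam v, forall i, inner (v i) (B (v i)) = (t i)%:C &
      forall e q, e \in es -> (size q <= n)%N ->
        poly_op q B e = \sum_i ((q.[t i])%:C * inner (v i) e) *: v i].
Proof.
move=> [lB sB].
have [m [g [og hg]]] := gram_schmidt [seq iter k B e | e <- es, k <- iota 0 n].
pose M : 'M[R[i]]_m := \matrix_(i, j) inner (g i) (B (g j)).
have hM : M \is hermsymmx.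
  apply/is_hermitianmxP; rewrite expr0 scale1r; apply/matrixP => i j.
  by rewrite !mxE -innerC sB.
have := orthomx_spectralP (hermitian_normalmx hM).
have := hermitian_spectral_diag_real hM.
have := spectral_unitarymx M.
move: (spectralmx M) (spectral_diag M) => P d uP dreal.
rewrite (invmx_unitary uP) => MPd.
have PPt := unitarymxP uP.
have PtP : P^t* *m P = 1%:M by rewrite -(invmx_unitary uP) mulVmx// unitarymx_unit.
have PMP : P *m M *m P^t* = diag_mx d.
  by rewrite MPd !mulmxA PPt mul1mx -mulmxA PPt mulmx1.
(* The eigenvectors of [M] are the columns of [P^t*], whence the conjugated entries of [P]. *)
pose v k := \sum_j (P k j)^* *: g j.
have vg k j : inner (v k) (g j) = P k j.
  by rewrite innerC inner_delta// conjCK.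
have vBv k l : inner (v k) (B (v l)) = (diag_mx d) k l.
  rewrite -PMP mxE /v linear_fun_sum// inner_sumr; apply: eq_bigr => j _.
  rewrite linear_funZ// innerZr inner_suml !mxE mulrC; congr (_ * _).
  by apply: eq_bigr => i _; rewrite innerZl conjCK !mxE.
have ov : orthofam v.
  move=> i j; have /matrixP/(_ i j) := PPt; rewrite !mxE => <-.
  rewrite {2}/v inner_sumr; apply: eq_bigr => b _.
  by rewrite innerZr vg !mxE mulrC.
have gv j : oproj v (g j) = g j.
  rewrite /oproj; under eq_bigr do rewrite vg /v scaler_sumr.
  rewrite exchange_big/= (bigD1 j)//= [X in _ + X]big1 => [|i ij].
    rewrite addr0; under eq_bigr do rewrite scalerA.
    have /matrixP/(_ j j) := PtP; rewrite !mxE eqxx => PtPj.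
    rewrite -scaler_suml -[RHS]scale1r; congr (_ *: _).
    by rewrite -[RHS]PtPj; apply: eq_bigr => k _; rewrite !mxE mulrC.
  under eq_bigr do rewrite scalerA.
  have /matrixP/(_ i j) := PtP; rewrite !mxE (negbTE ij) => PtPj.
  rewrite -scaler_suml -[RHS](scale0r (g i)); congr (_ *: _).
  by rewrite -[RHS]PtPj; apply: eq_bigr => k _; rewrite !mxE mulrC.
have xv x : oproj g x = x -> oproj v x = x.
  move=> gx; rewrite -{1}gx [oproj g x]/oproj.
  rewrite (linear_fun_sum _ _ (oproj_linear v)) -[RHS]gx; apply: eq_bigr => j _.
  by rewrite (linear_funZ _ _ (oproj_linear v)) gv.
pose t k := complex.Re (d 0 k).
have dt k : d 0 k = (t k)%:C.
  by rewrite /t RRe_real//; have /mxOverP := dreal; apply.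
have vBt k l : inner (v k) (B (v l)) = (t k)%:C * (k == l)%:R.
  by rewrite vBv !mxE dt mulr_natr.
(* The span need not be invariant under [B], so only the components of [B x] along the [v k] are
   computed. For [x = B^k e] with [k + 1 < n] they determine [B x]. *)
have eig x k : oproj v x = x -> inner (v k) (B x) = (t k)%:C * inner (v k) x.
  move=> vx; rewrite -{1}vx /oproj linear_fun_sum// inner_sumr (bigD1 k)//= big1.
    by rewrite addr0 linear_funZ// innerZr vBt eqxx mulr1 mulrC.
  by move=> l lk; rewrite linear_funZ// innerZr vBt eq_sym (negbTE lk) !mulr0.
have Ve e k : e \in es -> (k < n)%N -> oproj v (iter k B e) = iter k B e.
  move=> ee kn; apply/xv/hg; apply/allpairsP; exists (e, k).
  by rewrite mem_iota.
have pow e i k : e \in es -> (k < n)%N ->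
    inner (v i) (iter k B e) = ((t i) ^+ k)%:C * inner (v i) e.
  move=> ee; elim: k => [|k ih] kn; first by rewrite mul1r.
  by rewrite iterS eig ?Ve// 1?ltnW// ih 1?ltnW// exprS rmorphM/= mulrA.
exists m, v, t; split=> // [i|e q ee qn]; first by rewrite vBt eqxx mulr1.
rewrite (poly_op_widen _ _ qn).
transitivity (\sum_(k < n) \sum_i ((q`_k * (t i) ^+ k)%:C * inner (v i) e) *: v i).
  apply: eq_bigr => k _; rewrite -{1}(Ve e k)// /oproj scaler_sumr.
  by apply: eq_bigr => i _; rewrite pow// scalerA rmorphM/= mulrA.
rewrite exchange_big/=; apply: eq_bigr => i _.
rewrite -scaler_suml -mulr_suml; congr ((_ * _) *: _).
by rewrite (horner_coef_wide _ qn) rmorph_sum.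
Qed.

End polynomial_calculus.

(** * Positive operators and their continuous functional calculus *)

Section positive_operators.
Context {R : realType} {H : hilbertType R}.
Implicit Types (A B D : H -> H) (q r : {poly R}) (u v h : H) (f : R -> R).

(** Polarisation over the complex scalars: the sesquilinear defect [d] vanishes on the diagonal,
    hence is antisymmetric; replacing [u] by [i u] shows that it is symmetric as well. *)
Lemma positive_symmetric B : positive_op B -> symmetric_op B.
Proof.
move=> [[lB _] pB]; split=> // u v.
pose d a b := inner (B a) b - inner a (B b).
have d0 a : d a a = 0.
  apply/eqP; rewrite subr_eq0 innerC; have /ger0_real := pB a.
  by move=> /CrealP ->.
have dD a b : d a b + d b a = 0.
  have := d0 (a + b); rewrite /d linear_funD// !innerDl !innerDr.
  have := d0 a; have := d0 b; rewrite /d => hb ha h; rewrite -[RHS]h.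
  rewrite -[LHS]addr0 -ha -[LHS]addr0 -hb; ring.
have dZ a b : d ('i *: a) b = - 'i * d a b.
  by rewrite /d linear_funZ// !innerZl conjCi mulrBr.
have dZ' a b : d a ('i *: b) = 'i * d a b.
  by rewrite /d linear_funZ// !innerZr mulrBr.
have := dD ('i *: u) v; rewrite dZ dZ' => h2.
have h1 := dD u v.
have : 'i * d u v = 0 :> R[i].
  have : 'i * (d u v + d v u) - (- 'i * d u v + 'i * d v u) = 0.
    by rewrite h1 h2 mulr0 subr0.
  have -> : 'i * (d u v + d v u) - (- 'i * d u v + 'i * d v u) =
    2 * ('i * d u v) by ring.
  by move/eqP; rewrite mulf_eq0 pnatr_eq0/= => /eqP.
by move/eqP; rewrite mulf_eq0 (negbTE (neq0Ci _))/= subr_eq0 => /eqP.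
Qed.

Lemma symmetric_inner_real B h : symmetric_op B ->
  inner h (B h) = (complex.Re (inner h (B h)))%:C.
Proof. by move=> [_ sB]; apply: complex_eq_real; rewrite -innerC sB. Qed.

Lemma Re_inner_ge0 B h : positive_op B -> 0 <= complex.Re (inner h (B h)).
Proof. by move=> [_ /(_ h)]; rewrite lecE => /andP[]. Qed.

Lemma positive_opI B : bounded_op B -> (forall u v, inner (B u) v = inner u (B v)) ->
  (forall h, 0 <= complex.Re (inner h (B h))) -> positive_op B.
Proof.
move=> bB sB pB; split=> // h; rewrite symmetric_inner_real ?ler0c//.
by split=> //; case: bB.
Qed.

Lemma unit_form_bounds B v : positive_op B -> nr v = 1 ->
  0 <= complex.Re (inner v (B v)) <= opnorm B.
Proof.
move=> pB v1; have bB : bounded_op B by case: pB.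
rewrite Re_inner_ge0//= (le_trans (ler_norm _))// (le_trans (ler_Re_nr _))//.
rewrite (le_trans (cauchy_schwarz _ _))// v1 mul1r.
by rewrite (le_trans (opnormP _ bB))// v1 mulr1.
Qed.

(** Quadrature writes [<h, q(B) h>] as the sum of [q.[t i] |<v i, h>|^2], with nodes
    [t i = <v i, B (v i)>] in [[0, ||B||]]. *)
Lemma Re_inner_poly_op_ge0 B q h : positive_op B ->
  (forall t : R, 0 <= t <= opnorm B -> 0 <= q.[t]) ->
  0 <= complex.Re (inner h (poly_op q B h)).
Proof.
move=> pB q0; have sB := positive_symmetric pB.
have [m [v [t [ov tv hq]]]] := @quadrature _ _ B [:: h] (size q) sB.
rewrite (hq h q)// ?inE// inner_sumr Re_sum sumr_ge0// => i _.
rewrite innerZr -mulrA [_ * inner h _]mulrC [inner h _]innerC -nr_sqr -rmorphM/=.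
apply: mulr_ge0; last exact: sqr_ge0.
by apply: q0; have := unit_form_bounds pB (orthofam_nr i ov); rewrite tv.
Qed.

Lemma ler_Re_inner_poly_op B q r h : positive_op B ->
  (forall t : R, 0 <= t <= opnorm B -> q.[t] <= r.[t]) ->
  complex.Re (inner h (poly_op q B h)) <= complex.Re (inner h (poly_op r B h)).
Proof.
move=> pB qr; rewrite -subr_ge0 -ReN -ReD -innerBr -poly_opB.
by apply: Re_inner_poly_op_ge0 => // t ht; rewrite !hornerE subr_ge0 qr.
Qed.

(** [|q(B) h|^2 = <h, q^2(B) h>], which is compared with the constant polynomial [c^2]. *)
Lemma nr_poly_op B q h (c : R) : positive_op B -> 0 <= c ->
  (forall t : R, 0 <= t <= opnorm B -> `|q.[t]| <= c) ->
  nr (poly_op q B h) <= c * nr h.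
Proof.
move=> pB c0 qc; have sB := positive_symmetric pB; have lB := sB.1.
rewrite -(@ler_pXn2r _ 2)// ?nnegrE ?mulr_ge0 ?nr_ge0//.
have -> : nr (poly_op q B h) ^+ 2 = complex.Re (inner h (poly_op (q * q) B h)).
  by rewrite poly_opM// -poly_op_symmetric// inner_nr.
have -> : (c * nr h) ^+ 2 = complex.Re (inner h (poly_op (c ^+ 2)%:P B h)).
  by rewrite poly_opC innerZr inner_nr -rmorphM/= exprMn.
apply: ler_Re_inner_poly_op => // t ht.
by rewrite hornerM hornerC -expr2 -[leLHS](real_normK (num_real _)) lerXn2r ?nnegrE ?qc.
Qed.

Lemma poly_op_bounded q B : bounded_op B -> bounded_op (poly_op q B).
Proof.
move=> bB; have lB := bounded_op_lin bB.
apply: (@bounded_opI _ _ _ (\sum_(i < size q) `|q`_i| * opnorm B ^+ i) _ _).1.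
  exact: poly_op_linear.
move=> h; rewrite (le_trans (ler_nr_sum _ _))// mulr_suml ler_sum// => i _.
rewrite nrZ nr_real -mulrA ler_wpM2l//.
elim: (i : nat) => [|k ih]; first by rewrite expr0 mul1r.
by rewrite iterS exprS -mulrA (le_trans (opnormP _ bB))// ler_wpM2l ?opnorm_ge0.
Qed.

Lemma fun_calc_approx f A D (e : R) : is_fun_calc f A D -> bounded_op A -> 0 < e ->
  exists q, (forall t : R, 0 <= t <= opnorm A -> `|q.[t] - f t| <= e) /\
    forall h, nr (poly_op q A h - D h) <= e * nr h.
Proof.
move=> [bD hD] bA e0; have [q [qf qD]] := hD e e0; exists q; split=> // h.
have b : bounded_op (poly_op q A \- D) by apply: bounded_opB => //; exact: poly_op_bounded.
by rewrite (le_trans (opnormP h b))// ler_wpM2r ?nr_ge0.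
Qed.

(** Two polynomials close to [f] differ little on [[0, ||A||]], so [nr_poly_op] makes their values
    at [A] close. The vectors [q(A) h] converge for each [h], at a rate proportional to [|h|], hence
    in operator norm. *)
Lemma fun_calc_exists f A : positive_op A ->
  (forall e : R, 0 < e -> exists q,
    forall t : R, 0 <= t <= opnorm A -> `|q.[t] - f t| <= e) ->
  exists D, is_fun_calc f A D.
Proof.
move=> pA fapp; have bA : bounded_op A by case: pA.
have lA := bounded_op_lin bA.
pose close (e : R) q := forall t : R, 0 <= t <= opnorm A -> `|q.[t] - f t| <= e.
have diff h (d e : R) q r : 0 <= d -> 0 <= e -> close d q -> close e r ->
    nr (poly_op q A h - poly_op r A h) <= (d + e) * nr h.
  move=> d0 e0 hq hr; rewrite -poly_opB; apply: nr_poly_op => //.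
    exact: addr_ge0.
  move=> t ht; rewrite !hornerE.
  have -> : q.[t] - r.[t] = (q.[t] - f t) - (r.[t] - f t) by ring.
  by rewrite (le_trans (ler_normB _ _))// lerD ?hq ?hr.
have /choice[D hD] : forall h, exists w, forall e : R, 0 < e ->
    exists2 x, (exists2 q, close e q & x = poly_op q A h) & nr (w - x) < e.
  move=> h; apply: approx_limit.
  - by move=> e e0; have [q hq] := fapp e e0; exists (poly_op q A h), q.
  - by move=> e d ed x [q hq ->]; exists q => // t ht; rewrite (le_trans (hq t ht)).
  - move=> e e0; have h1 : 0 < nr h + 1 by rewrite ltr_wpDl ?nr_ge0.
    have d0 : 0 < e / (2 * (nr h + 1)) by rewrite divr_gt0// mulr_gt0.
    exists (e / (2 * (nr h + 1))) => // x y [q hq ->] [r hr ->].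
    apply: (le_lt_trans (diff _ _ _ _ _ (ltW d0) (ltW d0) hq hr)).
    have -> : e / (2 * (nr h + 1)) + e / (2 * (nr h + 1)) = e / (nr h + 1).
      by field; rewrite gt_eqF.
    by rewrite mulrAC ltr_pdivrMr// ltr_pM2l// ltrDl.
(* This holds for every polynomial close to [f]: it is compared with a far better one, [r], from the
   construction of [D h], whose own error then tends to 0. *)
have key q e h : 0 <= e -> close e q -> nr (poly_op q A h - D h) <= e * nr h.
  move=> e0 hq; apply/ler_addgt0Pr => d d0.
  have h1 : 0 < nr h + 1 by rewrite ltr_wpDl ?nr_ge0.
  have d1 : 0 < d / (nr h + 1) by rewrite divr_gt0.
  have [x [r hr ->] hx] := hD h _ d1.
  have -> : poly_op q A h - D h =
      (poly_op q A h - poly_op r A h) - (D h - poly_op r A h).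
    by rewrite opprB addrA subrK.
  rewrite (le_trans (ler_nrB _ _))//.
  rewrite (le_trans (lerD (diff _ _ _ _ _ e0 (ltW d1) hq hr) (ltW hx)))//.
  rewrite mulrDl -addrA lerD2l -{2}[d / _]mulr1 -mulrDr divfK// gt_eqF//.
have lD : linear D.
  move=> a u v; apply/eqP; rewrite -subr_eq0; apply/eqP/eq_nr_le => e e0.
  pose K := nr (a *: u + v) + nr a * nr u + nr v + 1.
  have K0 : 0 < K by rewrite ltr_wpDl// !addr_ge0 ?mulr_ge0 ?nr_ge0.
  have d0 : 0 < e / K by rewrite divr_gt0.
  have [q hq] := fapp _ d0.
  have k1 := key q _ (a *: u + v) (ltW d0) hq.
  have k2 := key q _ u (ltW d0) hq; have k3 := key q _ v (ltW d0) hq.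
  have -> : D (a *: u + v) - (a *: D u + D v) =
     a *: (poly_op q A u - D u) + (poly_op q A v - D v)
     - (poly_op q A (a *: u + v) - D (a *: u + v)).
    rewrite (poly_op_linear _ lA) scalerBr addrACA -opprD.
    by rewrite opprB [RHS]addrC addrA subrK.
  rewrite (le_trans (ler_nrB _ _))// (le_trans (lerD (ler_nrD _ _) (lexx _)))//.
  rewrite nrZ; apply: (@le_trans _ _ (e / K * (K - 1))); last first.
    rewrite mulrAC ler_pdivrMr// ler_wpM2l ?ltW//; lra.
  have : nr a * nr (poly_op q A u - D u) <= nr a * (e / K * nr u).
    by rewrite ler_wpM2l ?nr_ge0.
  have KE : K - 1 = nr (a *: u + v) + nr a * nr u + nr v by rewrite addrK.
  rewrite KE; move: k1 k2 k3; set c := e / K.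
  by move=> k1 k2 k3 k4; nra.
have bD : bounded_op D.
  have [q hq] := fapp 1 ltr01.
  apply: (@bounded_opI _ _ _ (opnorm (poly_op q A) + 1) _ _).1 => // h.
  have -> : D h = poly_op q A h - (poly_op q A h - D h) by rewrite opprB addrC subrK.
  rewrite (le_trans (ler_nrB _ _))// mulrDl lerD ?key//.
  by rewrite opnormP//; exact: poly_op_bounded.
exists D; split=> // e e0; have [q hq] := fapp e e0; exists q; split=> //.
apply: (@bounded_opI _ _ (poly_op q A \- D) e _ _).2; last exact: ltW.
  exact/bounded_op_lin/bounded_opB/bD/poly_op_bounded.
by move=> h; apply: key => //; exact: ltW.
Qed.

Lemma fun_calc_positive f A D : positive_op A -> is_fun_calc f A D ->
  (forall t : R, 0 <= t <= opnorm A -> 0 <= f t) -> positive_op D.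
Proof.
move=> pA fD f0; have bA : bounded_op A by case: pA.
have sA := positive_symmetric pA.
apply: positive_opI; first by case: fD.
  move=> u v; apply/eqP; rewrite -subr_eq0; apply/eqP/eq_nr_le => e e0.
  pose K := 2 * (nr u * nr v) + 1.
  have K0 : 0 < K by rewrite ltr_wpDl// mulr_ge0// mulr_ge0 ?nr_ge0.
  have [q [_ hq]] := fun_calc_approx fD bA (divr_gt0 e0 K0).
  have -> : inner (D u) v - inner u (D v) =
      inner u (poly_op q A v - D v) - inner (poly_op q A u - D u) v.
    by rewrite innerBl innerBr poly_op_symmetric//; ring.
  rewrite (le_trans (ler_nrB _ _))//.
  rewrite (le_trans (lerD (cauchy_schwarz _ _) (cauchy_schwarz _ _)))//.
  have h1 := ler_wpM2l (nr_ge0 u) (hq v).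
  have h2 := ler_wpM2r (nr_ge0 v) (hq u).
  have h3 : e / K * (K - 1) <= e.
    by rewrite mulrAC ler_pdivrMr// ler_wpM2l ?(ltW e0)//; lra.
  have KE : K - 1 = 2 * (nr u * nr v) by rewrite addrK.
  rewrite KE in h3; move: h1 h2 h3; set c := e / K => h1 h2 h3; nra.
move=> h; apply/ler_addgt0Pr => e e0.
pose K := 2 * nr h ^+ 2 + 1.
have K0 : 0 < K by rewrite ltr_wpDl// mulr_ge0// sqr_ge0.
have eK0 : 0 < e / K by rewrite divr_gt0.
have [q [qf hq]] := fun_calc_approx fD bA eK0.
have q0 : - (e / K) * nr h ^+ 2 <= complex.Re (inner h (poly_op q A h)).
  have -> : - (e / K) * nr h ^+ 2 =
      complex.Re (inner h (poly_op (- (e / K))%:P A h)).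
    by rewrite poly_opC innerZr inner_nr -rmorphM.
  apply: ler_Re_inner_poly_op => // t ht; rewrite hornerC.
  by have := qf t ht; have := f0 t ht; rewrite ler_norml => ? /andP[? _]; lra.
have : `|complex.Re (inner h (poly_op q A h - D h))| <= e / K * nr h ^+ 2.
  rewrite (le_trans (ler_Re_nr _))// (le_trans (cauchy_schwarz _ _))//.
  by have := ler_wpM2l (nr_ge0 h) (hq h); rewrite mulrCA -expr2.
rewrite innerBr ReD ReN ler_norml => /andP[_].
have h3 : e / K * (K - 1) <= e.
  by rewrite mulrAC ler_pdivrMr// ler_wpM2l ?(ltW e0)//; lra.
have KE : K - 1 = 2 * nr h ^+ 2 by rewrite addrK.
rewrite KE in h3; move: h3 q0; set c := e / K => h3 q0; nra.
Qed.

End positive_operators.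

(** * Square roots, approximate polar decomposition, powers *)

Section roots.
Context {R : realType} {H : hilbertType R}.
Implicit Types (A B D : H -> H) (q r : {poly R}) (u v h : H).

Lemma positive_sqrt_exists A : positive_op A ->
  exists D, positive_op D /\ D \o D = A.
Proof.
move=> pA; have bA : bounded_op A by case: pA.
have lA := bounded_op_lin bA; have sA := positive_symmetric pA.
have [D fD] := fun_calc_exists pA (fun e => @sqrt_poly_approx R (opnorm A) e).
exists D; split; first by apply: fun_calc_positive fD _ => // t _; rewrite sqrtr_ge0.
apply/funext => h /=; apply/eqP; rewrite -subr_eq0; apply/eqP/eq_nr_le => e e0.
pose M := Num.sqrt (opnorm A).
have M0 : 0 <= M by rewrite sqrtr_ge0.
(* [D (D h) - A h] has three errors: that of [q(A)] against [D] at [D h], the same at [h] followed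
   by [q(A)], and that of [q^2] against [t]. The bound [d <= 1] gives [|q| <= M + 1]. *)
pose K := nr (D h) + (M + 1) * nr h + (2 * M + 1) * nr h + 1.
have K0 : 0 < K.
  by rewrite ltr_wpDl// !addr_ge0 ?nr_ge0// mulr_ge0 ?nr_ge0// addr_ge0// mulr_ge0.
pose d := Num.min 1 (e / K).
have d0 : 0 < d by rewrite lt_min ltr01 divr_gt0.
have d1 : d <= 1 by rewrite ge_min lexx.
have dK : d * K <= e by rewrite -ler_pdivlMr// ge_min lexx orbT.
have [q [qf hq]] := fun_calc_approx fD bA d0.
have root_le t : 0 <= t <= opnorm A -> Num.sqrt t <= M.
  by move=> /andP[t0 tA]; rewrite ler_wsqrtr.
have qM t : 0 <= t <= opnorm A -> `|q.[t]| <= M + 1.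
  move=> ht; rewrite -(subrK (Num.sqrt t) q.[t]) addrC (le_trans (ler_normD _ _))//.
  rewrite ger0_norm ?sqrtr_ge0// lerD ?root_le//.
  exact: le_trans (qf t ht) d1.
have -> : D (D h) - A h = (poly_op q A (poly_op q A h) - A h)
    - poly_op q A (poly_op q A h - D h) - (poly_op q A (D h) - D (D h)).
  rewrite (linear_funB _ _ (poly_op_linear q lA)) !opprB.
  by rewrite [RHS]addrC [X in _ = _ + X]addrC [X in _ = _ + X]addrA subrK addrA subrK.
have k1 : nr (poly_op q A (D h) - D (D h)) <= d * nr (D h) by [].
have k2 : nr (poly_op q A (poly_op q A h - D h)) <= (M + 1) * (d * nr h).
  rewrite (le_trans (nr_poly_op _ pA _ qM)) ?addr_ge0//.
  by rewrite ler_wpM2l// addr_ge0.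
have k3 : nr (poly_op q A (poly_op q A h) - A h) <= (d * (2 * M + 1)) * nr h.
  rewrite -poly_opM// -(poly_opX h lA) -poly_opB.
  apply: nr_poly_op => //; first by rewrite mulr_ge0 ?(ltW d0)// addr_ge0// mulr_ge0.
  move=> t ht; have /andP[t0 _] := ht.
  rewrite hornerD hornerN hornerM hornerX -expr2 -{2}(sqr_sqrtr t0) subr_sqr normrM.
  rewrite ler_pM ?qf// (le_trans (ler_normD _ _))// (ger0_norm (sqrtr_ge0 _)).
  by have := root_le t ht; have := qM t ht; lra.
rewrite (le_trans (ler_nrB _ _))// (le_trans (lerD (ler_nrB _ _) (lexx _)))//.
apply: (le_trans _ dK); rewrite /K; nra.
Qed.

Lemma absop_spec A : bounded_op A ->
  positive_op (absop A) /\ absop A \o absop A = adjoint A \o A.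
Proof.
move=> bA; have [bA' aA] := adjoint_spec bA.
have p : positive_op (adjoint A \o A).
  split=> [|h]; first exact: bounded_op_comp.
  by rewrite /= -aA inner_nr ler0c sqr_ge0.
have [D hD] := positive_sqrt_exists p.
by rewrite /absop; case: xgetP => [? _ //|/(_ D)].
Qed.

Lemma absop_inner A u v : bounded_op A ->
  inner (absop A u) (absop A v) = inner (A u) (A v).
Proof.
move=> bA; have [pB BB] := absop_spec bA; have [_ sB] := positive_symmetric pB.
by rewrite sB -[absop A (absop A v)]/((absop A \o absop A) v) BB (adjoint_spec bA).2.
Qed.

Lemma nr_absop A u : bounded_op A -> nr (absop A u) = nr (A u).
Proof.
move=> bA; have := absop_inner u u bA; rewrite !inner_nr => /RtoC_inj/eqP.
by rewrite eqrXn2 ?nr_ge0// => /eqP.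
Qed.

Lemma nr_adjoint_le A (c : R) h : bounded_op A -> 0 <= c ->
  (forall u, nr (A u) <= c * nr u) -> nr (adjoint A h) <= c * nr h.
Proof.
move=> bA c0 hc; have [bA' aA] := adjoint_spec bA.
have [->|n0] := eqVneq (nr (adjoint A h)) 0; first by rewrite mulr_ge0 ?nr_ge0.
have n1 : 0 < nr (adjoint A h) by rewrite lt_neqAle eq_sym n0 nr_ge0.
rewrite -(ler_pM2r n1) -expr2 -[leLHS]ger0_norm ?sqr_ge0//.
rewrite -nr_real -inner_nr -aA (le_trans (cauchy_schwarz _ _))//.
by rewrite mulrAC ler_wpM2r ?nr_ge0.
Qed.

(* With [u = 1 - X / M], the contraction is [A r(|A|)] where
   [X r = 1 - u ^ n], and the error is governed by [X u ^ n <= M / n]. *)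
Lemma approx_polar A (e : R) : bounded_op A -> 0 < e ->
  exists W, [/\ bounded_op W, forall h, nr (W h) <= nr h,
    forall h, nr (A h - W (absop A h)) <= e * nr h &
    forall h k, nr (inner (W h) (A k) - inner h (absop A k)) <= e * (nr h * nr k)].
Proof.
move=> bA e0; set B := absop A.
have [pB _] := absop_spec bA; rewrite -/B in pB.
have [lB sB] := positive_symmetric pB; have bB : bounded_op B by case: pB.
pose M := opnorm B + 1.
have M0 : 0 < M by rewrite ltr_wpDl// opnorm_ge0.
have [n n0 nM] : exists2 n : nat, 0 < n%:R :> R & M / n%:R <= e.
  exists (Num.truncn (M / e)).+1; first by rewrite ltr0n.
  rewrite ler_pdivrMr ?ltr0n// mulrC -ler_pdivrMr//.
  exact/ltW/truncnS_gt.
pose u : {poly R} := 1 - M^-1 *: 'X.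
pose r : {poly R} := M^-1 *: \sum_(k < n) u ^+ k.
have Xr : 'X * r = 1 - u ^+ n.
  have u1 : 1 - u = M^-1 *: 'X by rewrite /u opprB addrC subrK.
  rewrite -[1 - u ^+ n]opprB subrX1 -mulNr opprB u1 /r.
  by rewrite -scalerAr scalerAl.
have u01 (t : R) : 0 <= t <= opnorm B -> 0 <= u.[t] <= 1.
  move=> /andP[t0 tB]; rewrite /u !hornerE subr_ge0 mulrC ler_pdivrMr// mul1r.
  rewrite (le_trans tB) ?lerDl//= gerBl divr_ge0// ltW//.
have ut (t : R) : t = M * (1 - u.[t]) by rewrite /u !hornerE; field; rewrite gt_eqF.
clearbody u.
(* [n x^n] is at most the geometric sum [1 + ... + x^(n-1)], and [1 - x] times that sum is
   [1 - x^n]. *)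
have nun (t : R) : 0 <= t <= opnorm B -> (1 - u.[t]) * u.[t] ^+ n <= n%:R^-1.
  move=> ht; have /andP[x0 x1] := u01 t ht; set x := u.[t] in x0 x1 *.
  rewrite -[leRHS]mul1r ler_pdivlMr//.
  apply: (@le_trans _ _ ((1 - x) * \sum_(k < n) x ^+ k)).
    rewrite -mulrA ler_wpM2l ?subr_ge0//.
    have -> : x ^+ n * n%:R = \sum_(k < n) x ^+ n.
      by rewrite sumr_const card_ord mulr_natr.
    by apply: ler_sum => k _; rewrite ler_wiXn2l// ltnW.
  by rewrite -opprB mulNr -subrX1 opprB gerBl exprn_ge0.
have rB h : B (poly_op r B h) = poly_op (1 - u ^+ n) B h by rewrite -poly_opXM// Xr.
have err h : nr (B h - poly_op (1 - u ^+ n) B (B h)) <= e * nr h.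
  rewrite -(poly_opX h lB) -poly_opM// -poly_opB.
  apply: nr_poly_op => //; first exact: ltW.
  move=> t ht; have /andP[x0 x1] := u01 t ht; have /andP[t0 _] := ht.
  rewrite !hornerE.
  have -> : t - (1 - u.[t] ^+ n) * t = t * u.[t] ^+ n by ring.
  rewrite ger0_norm ?mulr_ge0 ?exprn_ge0// {1}(ut t) -mulrA (le_trans _ nM)//.
  by rewrite ler_wpM2l ?nun// ltW.
have lA := bounded_op_lin bA.
(* [A v] and [absop A v] have the same norm and [A] can be traded for [absop A] in inner products,
   so all estimates reduce to the polynomial [X r = 1 - u^n]. *)
exists (A \o poly_op r B); split.
- by apply: bounded_op_comp => //; exact: poly_op_bounded.
- move=> h /=; rewrite -nr_absop// -/B rB -[leRHS]mul1r.
  apply: nr_poly_op => // t ht; have /andP[x0 x1] := u01 t ht.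
  rewrite !hornerE ger0_norm ?gerBl ?exprn_ge0//.
  by rewrite subr_ge0 exprn_ile1.
- move=> h /=; rewrite -linear_funB// -nr_absop// -/B linear_funB// rB.
  exact: err.
- move=> h k /=; rewrite -absop_inner// -/B rB.
  rewrite poly_op_symmetric//.
  rewrite -innerBr (le_trans (cauchy_schwarz _ _))// mulrCA.
  by rewrite ler_wpM2l ?nr_ge0// nr_distC err.
Qed.

Lemma powop_spec B (p : R) : positive_op B -> 1 <= p ->
  is_fun_calc (fun t => t `^ p) B (powop B p).
Proof.
move=> pB p1.
have [D hD] := fun_calc_exists pB (fun e => @powR_poly_approx R (opnorm B) p e p1).
by rewrite /powop; case: xgetP => [? _ //|/(_ D)].
Qed.

Lemma powop_positive B (p : R) : positive_op B -> 1 <= p -> positive_op (powop B p).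
Proof.
move=> pB p1; apply: fun_calc_positive (powop_spec pB p1) _ => // t _.
exact: powR_ge0.
Qed.

(* Jensen's inequality, from the tangent line of [t ^ p] at [<e, B e>] *)
Lemma powop_jensen B (p : R) e : positive_op B -> 1 <= p -> nr e <= 1 ->
  complex.Re (inner e (B e)) `^ p <= complex.Re (inner e (powop B p e)).
Proof.
move=> pB p1 e1; have bB : bounded_op B by case: pB.
have lB := bounded_op_lin bB.
have s0 := Re_inner_ge0 e pB; set s := complex.Re _ in s0 *.
apply/ler_addgt0Pr => d d0.
have d20 : 0 < d / 2 by rewrite divr_gt0.
have [q [qf hq]] := fun_calc_approx (powop_spec pB p1) bB d20.
pose a := p * s `^ (p - 1).
(* The tangent line at [s], lowered by [d / 2] so that it stays below [q] on [[0, ||B||]]. *)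
pose l : {poly R} := (s `^ p - a * s)%:P + a *: 'X - (d / 2)%:P.
have lq : complex.Re (inner e (poly_op l B e)) <= complex.Re (inner e (poly_op q B e)).
  apply: ler_Re_inner_poly_op => // t ht; have /andP[t0 _] := ht.
  rewrite /l !hornerE.
  have := powR_tangent p1 s0 t0; rewrite -/a.
  by have := qf t ht; rewrite ler_norml => /andP[? _]; lra.
have : `|complex.Re (inner e (poly_op q B e - powop B p e))| <= d / 2.
  rewrite (le_trans (ler_Re_nr _))// (le_trans (cauchy_schwarz _ _))//.
  rewrite -[leRHS]mul1r ler_pM ?nr_ge0// (le_trans (hq e))//.
  by rewrite ler_piMr// ltW.
rewrite innerBr ReD ReN ler_norml => /andP[_].
move: lq; rewrite /l poly_opB poly_opD poly_opZ !poly_opC poly_opX//.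
rewrite innerBr innerDr !innerZr inner_nr ReD ReN ReD !ReZ/= -/s.
have p0 : 0 < p by apply: lt_le_trans p1.
have as_ : a * s = p * s `^ p by rewrite /a -mulrA [_ * s]mulrC mulr_powRB1.
have n1 : nr e ^+ 2 <= 1 by rewrite expr_le1// nr_ge0.
(* The constant term of the tangent is [(1 - p) s^p <= 0], so having [|e| <= 1] instead of [|e| = 1]
   can only help. This admits Bessel systems. *)
have : 0 <= (p - 1) * s `^ p * (1 - nr e ^+ 2).
  by rewrite mulr_ge0 ?subr_ge0// mulr_ge0 ?powR_ge0// subr_ge0.
have : 0 <= nr e ^+ 2 by exact: sqr_ge0.
by rewrite as_; set N := nr e ^+ 2 in n1 *; set S := s `^ p; nra.
Qed.

End roots.

(** * The trace and its description by pairings of Bessel systems *)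

Section traces.
Context {R : realType} {H : hilbertType R}.
Implicit Types (A B C D : H -> H) (u v h : H) (I : finType) (p c : R).

Definition trace_basis : set H := xget set0 [set E | is_orthonormal_basis E].

Lemma trace_basisP : is_orthonormal_basis trace_basis.
Proof.
rewrite /trace_basis; have [E hE] := @orthonormal_basis_exists R H.
by case: xgetP => [? _ //|/(_ E)].
Qed.

Lemma trace_ge0 C : positive_op C -> (0 <= trace C)%E.
Proof. by move=> pC; apply: esum_ge0 => e _; rewrite lee_fin Re_inner_ge0. Qed.

Lemma ge_sum_trace C (l : seq H) : uniq l -> {in l, forall e, trace_basis e} ->
  ((\sum_(e <- l) complex.Re (inner e (C e)))%:E <= trace C)%E.
Proof.
move=> ul lb; apply: esum_ge; exists [set` l].
  by split; [exact: finite_seq | move=> e /= el; exact: lb].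
by rewrite -fsbig_seq// sumEFin.
Qed.

Lemma trace_le_sum C c : (forall l, uniq l -> {in l, forall e, trace_basis e} ->
    \sum_(e <- l) complex.Re (inner e (C e)) <= c) ->
  (trace C <= c%:E)%E.
Proof.
move=> h; apply: ge_ereal_sup => _ [F [/finite_seqP[s Fs] Fb] <-].
have -> : F = [set` undup s].
  by rewrite Fs; apply/seteqP; split=> x /=; rewrite mem_undup.
rewrite -fsbig_seq ?undup_uniq// sumEFin lee_fin; apply: h.
  exact: undup_uniq.
by move=> e; rewrite mem_undup => es; apply: Fb; rewrite Fs.
Qed.

Lemma bessel_nr_le1 I (e : I -> H) i : bessel e -> nr (e i) <= 1.
Proof.
move=> /(_ (e i)); rewrite (bigD1 i)//= inner_nr nr_real ger0_norm ?sqr_ge0// => h.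
have [->|n0] := eqVneq (nr (e i)) 0; first exact: ler01.
have n1 : 0 < nr (e i) ^+ 2.
  by rewrite exprn_gt0// lt_neqAle eq_sym n0 nr_ge0.
rewrite -(@ler_pXn2r _ 2)// ?nnegrE ?nr_ge0// expr1n -(ler_pM2l n1) mulr1 -expr2.
by apply: le_trans h; rewrite lerDl sumr_ge0// => j _; rewrite sqr_ge0.
Qed.

Lemma bessel_comp I (W : H -> H) (e : I -> H) : bounded_op W ->
  (forall h, nr (W h) <= nr h) -> bessel e -> bessel (W \o e).
Proof.
move=> bW cW be h.
have aW : nr (adjoint W h) <= 1 * nr h.
  by apply: nr_adjoint_le => // u; rewrite mul1r.
rewrite mul1r in aW; apply: (@le_trans _ _ (nr (adjoint W h) ^+ 2)); last first.
  by rewrite lerXn2r ?nnegrE ?nr_ge0.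
apply: le_trans (be (adjoint W h)).
by under eq_bigr do rewrite /= (adjoint_spec bW).2.
Qed.

Lemma bessel_comp_adjoint I (W : H -> H) (e : I -> H) : bounded_op W ->
  (forall h, nr (W h) <= nr h) -> bessel e -> bessel (adjoint W \o e).
Proof.
move=> bW cW be h; apply: (@le_trans _ _ (nr (W h) ^+ 2)); last first.
  by rewrite lerXn2r ?nnegrE ?nr_ge0.
apply: le_trans (be (W h)).
by under eq_bigr do rewrite /= -inner_adjoint//.
Qed.

(** With [C = D^2], Parseval expands [|D (e i)|^2] in the basis of [trace]. After exchanging the
    sums, Bessel's inequality for [e] at [D f] bounds the share of each basis vector [f] by
    [|D f|^2]. *)
Lemma bessel_sum_le_trace C I (e : I -> H) : positive_op C -> bessel e ->
  ((\sum_i complex.Re (inner (e i) (C (e i))))%:E <= trace C)%E.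
Proof.
move=> pC be; have [D [pD DD]] := positive_sqrt_exists pC.
have [lD sD] := positive_symmetric pD.
have CD h : complex.Re (inner h (C h)) = nr (D h) ^+ 2.
  by rewrite -DD /= -sD inner_nr.
under eq_bigr do rewrite CD.
apply/lee_addgt0Pr => d d0.
pose N : R := #|I|%:R + 1.
have N0 : 0 < N by rewrite ltr_wpDl.
have dN : 0 < d / N by rewrite divr_gt0.
have /choice[l hl] : forall i, exists l : seq H, {in l, forall f, trace_basis f} /\
    forall l', {in l', forall f, trace_basis f} -> uniq l' -> {subset l <= l'} ->
    nr (D (e i)) ^+ 2 <= \sum_(f <- l') nr (inner f (D (e i))) ^+ 2 + d / N.
  by move=> i; exact: parseval_approx trace_basisP dN.
(* One finite part of the basis that is good for all [i]: the approximate Parseval estimate holds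
   for every duplicate-free list of basis vectors that contains [l i]. *)
pose L := undup (flatten [seq l i | i : I]).
have LE : {in L, forall f, trace_basis f}.
  move=> f; rewrite mem_undup => /flattenP[_ /mapP[i _ ->]]; exact: (hl i).1.
have uL : uniq L by exact: undup_uniq.
have lL i : {subset l i <= L}.
  move=> f fl; rewrite mem_undup; apply/flattenP; exists (l i) => //.
  by apply: map_f; rewrite mem_enum.
apply: (@le_trans _ _ (\sum_(f <- L) nr (D f) ^+ 2 + d)%:E).
  rewrite lee_fin.
  apply: (@le_trans _ _ (\sum_i (\sum_(f <- L) nr (inner f (D (e i))) ^+ 2 + d / N))).
    by apply: ler_sum => i _; apply: (hl i).2.
  rewrite big_split/= lerD//.
    rewrite exchange_big/=; apply: ler_sum => f _.
    apply: le_trans (be (D f)); apply: ler_sum => i _.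
    by rewrite -sD nr_innerC.
  rewrite sumr_const -mulr_natl mulrCA ler_piMr ?(ltW d0)//.
  by rewrite ler_pdivrMr// mul1r lerDl.
rewrite EFinD leeD2r//.
apply: le_trans (ge_sum_trace C uL LE).
by rewrite lee_fin; under [leRHS]eq_bigr do rewrite CD.
Qed.

(* The least such [c] is [tr |A|^p], by the two lemmas below. Orthonormal
   families would give the same suprema, but Bessel systems are
   stable under contractions, which avoids polar decompositions. *)
Definition pairing_bound p c (A : H -> H) :=
  forall I (e f : I -> H), bessel e -> bessel f ->
    \sum_i nr (inner (f i) (A (e i))) `^ p <= c.

Lemma trace_abs_pow_ge0 p A : 1 <= p -> bounded_op A -> (0 <= trace_abs_pow p A)%E.
Proof.
move=> p1 bA; apply/trace_ge0/powop_positive => //.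
by have [] := absop_spec bA.
Qed.

Lemma pairing_bound_of_trace p c A : 1 <= p -> bounded_op A ->
  (trace_abs_pow p A <= c%:E)%E -> pairing_bound p c A.
Proof.
move=> p1 bA tc I e f be bf.
have p0 : 0 <= p by apply: le_trans p1.
set B := absop A; have [pB _] := absop_spec bA; rewrite -/B in pB.
apply: le_sum_powR_limit => // [i|d d0]; first exact: nr_ge0.
have [W [bW cW AW _]] := approx_polar bA d0.
pose g := adjoint W \o f.
have bg : bessel g by exact: bessel_comp_adjoint.
have [D [pD DD]] := positive_sqrt_exists pB.
have [_ sD] := positive_symmetric pD.
have BD h : complex.Re (inner h (B h)) = nr (D h) ^+ 2.
  by rewrite -DD /= -sD inner_nr.
(* [(x y)^p <= (x^(2p) + y^(2p)) / 2] with [x = |D (g i)|] and [y = |D (e i)|]. Here [x^2] and [y^2]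
   are values of the form of [B] at [g i] and [e i], so Jensen's inequality applies to both
   halves. *)
have term i : Num.max (nr (inner (f i) (A (e i))) - d) 0 `^ p <=
    2^-1 * (complex.Re (inner (g i) (powop B p (g i))) +
            complex.Re (inner (e i) (powop B p (e i)))).
  apply: (@le_trans _ _ ((nr (D (g i)) * nr (D (e i))) `^ p)).
    apply: ge0_ler_powR => //; rewrite ?nnegrE ?le_max ?lexx ?orbT//.
      by rewrite mulr_ge0 ?nr_ge0.
    rewrite ge_max mulr_ge0 ?nr_ge0// andbT lerBlDr.
    rewrite -[A (e i)](subrK (W (B (e i)))) innerDr (le_trans (ler_nrD _ _))//.
    rewrite addrC lerD//.
      by rewrite inner_adjoint// -DD /= -sD cauchy_schwarz.
    rewrite (le_trans (cauchy_schwarz _ _))// -[leRHS]mul1r.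
    rewrite ler_pM ?nr_ge0 ?bessel_nr_le1// (le_trans (AW _))//.
    by rewrite ler_piMr ?(ltW d0)// bessel_nr_le1.
  rewrite powRM ?nr_ge0//.
  have sq h : (nr (D h) `^ p) ^+ 2 = complex.Re (inner h (B h)) `^ p.
    by rewrite BD !expr2 powRM ?nr_ge0.
  have jg := powop_jensen pB p1 (bessel_nr_le1 i bg).
  have je := powop_jensen pB p1 (bessel_nr_le1 i be).
  rewrite -sq in jg; rewrite -sq in je.
  have := sqr_ge0 (nr (D (g i)) `^ p - nr (D (e i)) `^ p).
  by rewrite sqrrB; move: jg je; set x := _ `^ p; set y := _ `^ p; lra.
apply: (le_trans (ler_sum _ (fun i _ => term i))).
rewrite -mulr_sumr big_split/=.
have pP := powop_positive pB p1.
have h1 := le_trans (bessel_sum_le_trace pP bg) tc.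
have h2 := le_trans (bessel_sum_le_trace pP be) tc.
rewrite !lee_fin in h1 h2; lra.
Qed.

Lemma trace_of_pairing_bound p c A : 1 <= p -> bounded_op A ->
  pairing_bound p c A -> (trace_abs_pow p A <= c%:E)%E.
Proof.
move=> p1 bA hA.
set B := absop A; have [pB _] := absop_spec bA; rewrite -/B in pB.
have bB : bounded_op B by case: pB.
have sB := positive_symmetric pB.
apply: trace_le_sum => l ul lb; apply/ler_addgt0Pr => d d0.
pose N : R := (size l)%:R.
have N0 : 0 <= N by rewrite ler0n.
(* Each of the [N] basis vectors costs [2 d']: one [d'] for [q(B)] in place of [B^p], one for
   [q.[t i]] in place of [(t i)^p]. The 1 covers the empty list. *)
pose d' := d / (2 * N + 1).
have d'0 : 0 < d' by rewrite divr_gt0// ltr_wpDl// mulr_ge0.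
have [q [qf hq]] := fun_calc_approx (powop_spec pB p1) bB d'0.
(* [q] is fixed before the compression, since its size decides how many powers of [B] the Krylov
   space must contain. *)
have [m [v [t [ov tv hv]]]] := quadrature l (size q) sB.
have v1 i : nr (v i) = 1 by exact: orthofam_nr.
have tB i : 0 <= t i <= opnorm B.
  have := unit_form_bounds pB (v1 i); by rewrite tv.
have bl : bessel (tnth (in_tuple l)).
  by apply/orthofam_bessel/(orthoset_seq trace_basisP.1).
have bv : bessel v by exact: orthofam_bessel.
have tc : \sum_i t i `^ p <= c.
  apply: le_sum_powR_limit => // [i|e e0]; first by case/andP: (tB i).
  have [W [bW cW _ AW]] := approx_polar bA e0.
  apply: le_trans (hA _ _ _ bv (bessel_comp bW cW bv)).
  apply: ler_sum => i _; apply: ge0_ler_powR; rewrite ?nnegrE ?le_max ?lexx ?orbT ?nr_ge0//.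
    exact: le_trans p1.
  rewrite ge_max nr_ge0 andbT lerBlDr.
  have := AW (v i) (v i); rewrite !v1 !mulr1 tv nr_distC => h.
  have := ler_nrD ((t i)%:C - inner (W (v i)) (A (v i))) (inner (W (v i)) (A (v i))).
  rewrite subrK nr_real ger0_norm; last by case/andP: (tB i).
  by move=> h'; rewrite (le_trans h')// addrC lerD2l.
have basis1 e : e \in l -> nr e = 1.
  move=> el; have := trace_basisP.1 _ _ (lb _ el) (lb _ el); rewrite eqxx inner_nr.
  move=> /RtoC_inj/eqP; rewrite sqrf_eq1 => /orP[/eqP//|/eqP h].
  by have := nr_ge0 e; rewrite h; lra.
have term e : e \in l -> complex.Re (inner e (powop B p e)) <=
    \sum_i t i `^ p * nr (inner (v i) e) ^+ 2 + 2 * d'.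
  move=> el.
  have : `|complex.Re (inner e (poly_op q B e - powop B p e))| <= d'.
    rewrite (le_trans (ler_Re_nr _))// (le_trans (cauchy_schwarz _ _))//.
    by rewrite basis1// mul1r (le_trans (hq e))// basis1// mulr1.
  rewrite innerBr ReD ReN ler_norml => /andP[+ _].
  have : complex.Re (inner e (poly_op q B e)) <=
      \sum_i (t i `^ p + d') * nr (inner (v i) e) ^+ 2.
    rewrite hv// inner_sumr Re_sum; apply: ler_sum => i _.
    rewrite innerZr -mulrA [_ * inner e _]mulrC [inner e _]innerC -nr_sqr -rmorphM/=.
    rewrite ler_wpM2r ?sqr_ge0//.
    by have := qf _ (tB i); rewrite ler_norml => /andP[_]; lra.
  under eq_bigr do rewrite mulrDl.
  rewrite big_split/= -mulr_sumr.
  have : d' * \sum_i nr (inner (v i) e) ^+ 2 <= d'.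
    rewrite ler_piMr ?(ltW d'0)//; have := bv e.
    by rewrite basis1// expr1n.
  by lra.
apply: (@le_trans _ _ (\sum_(e <- l) (\sum_i t i `^ p * nr (inner (v i) e) ^+ 2 + 2 * d'))).
  by rewrite big_seq [leRHS]big_seq; apply: ler_sum => e; exact: term.
rewrite big_split/= lerD//.
  (* For fixed [i] the weights [|<v i, e>|^2] sum over the list to at most 1, by Bessel's inequality
     for [l]. *)
  rewrite exchange_big/=; apply: le_trans tc; apply: ler_sum => i _.
  rewrite -mulr_sumr ler_piMr ?powR_ge0//.
  have := bl (v i); rewrite v1 expr1n; apply: le_trans.
  rewrite big_tnth; apply: ler_sum => j _.
  by rewrite nr_innerC.
rewrite big_tnth sumr_const card_ord -[leLHS]mulr_natl -/N /d'.
have -> : N * (2 * (d / (2 * N + 1))) = d * (2 * N / (2 * N + 1)) by ring.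
rewrite ler_piMr ?(ltW d0)// ler_pdivrMr ?ltr_wpDl ?mulr_ge0//.
by rewrite mul1r lerDl.
Qed.

(** Replaces the extended-real norm by inequalities between finite real sums, where the triangle
    inequality and the compressions are carried out. *)
Lemma schatten_norm_leP p a A : 1 <= p -> bounded_op A -> 0 <= a ->
  (schatten_norm p A <= a%:E)%E <-> pairing_bound p (a `^ p) A.
Proof.
move=> p1 bA a0; have p0 : 0 < p by apply: lt_le_trans p1.
have t0 := trace_abs_pow_ge0 p1 bA.
split=> [h|/(trace_of_pairing_bound p1 bA) h].
  apply: pairing_bound_of_trace => //.
  have -> : trace_abs_pow p A = poweR (schatten_norm p A) p.
    by rewrite /schatten_norm -poweRrM mulVf ?gt_eqF// poweRe1.
  rewrite -poweR_EFin gt0_ler_poweR ?(ltW p0)// in_itv/= ?lee_fin ?a0 ?leey//.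
  by rewrite poweR_ge0.
have -> : a%:E = poweR ((a `^ p)%:E) p^-1.
  by rewrite poweR_EFin -powRrM divff ?gt_eqF// powRr1.
rewrite /schatten_norm gt0_ler_poweR// ?invr_ge0 ?(ltW p0)// in_itv/= ?leey ?andbT//.
by rewrite lee_fin powR_ge0.
Qed.

End traces.

(** * Triangle inequality, finite rank and compressions *)

Section schatten_norms.
Context {R : realType} {H : hilbertType R}.
Implicit Types (A B C : H -> H) (u v h : H) (I : finType) (p a b c : R).

Lemma pairing_bound_le p c c' A : c <= c' -> pairing_bound p c A -> pairing_bound p c' A.
Proof. by move=> cc' hA I e f be bf; apply: le_trans (hA _ _ _ be bf) cc'. Qed.

Lemma pairing_boundN p c A : pairing_bound p c A -> pairing_bound p c (\- A).
Proof.
move=> hA I e f be bf; apply: le_trans (hA _ _ _ be bf).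
by apply: ler_sum => i _; rewrite innerNr nrN.
Qed.

(** The triangle inequality. The pairings of the sum are at most [a + b] times a convex combination
    of the scaled pairings [x] and [y]; convexity of [t^p] comes from the tangent at that
    combination. The scaling divides by [a] and [b], hence their positivity. *)
Lemma pairing_boundD p a b A B : 1 <= p -> 0 < a -> 0 < b ->
  pairing_bound p (a `^ p) A -> pairing_bound p (b `^ p) B ->
  pairing_bound p ((a + b) `^ p) (A \+ B).
Proof.
move=> p1 a0 b0 hA hB I e f be bf.
have p0 : 0 <= p by apply: le_trans p1.
have ab0 : 0 < a + b by rewrite addr_gt0.
pose x i := nr (inner (f i) (A (e i))) / a.
pose y i := nr (inner (f i) (B (e i))) / b.
have x0 i : 0 <= x i by rewrite divr_ge0 ?nr_ge0 ?ltW.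
have y0 i : 0 <= y i by rewrite divr_ge0 ?nr_ge0 ?ltW.
have normalize (d : R) (z : I -> R) : 0 < d -> (forall i, 0 <= z i) ->
    \sum_i z i `^ p <= d `^ p -> \sum_i (z i / d) `^ p <= 1.
  move=> d0 z0 hz; rewrite -(ler_pM2l (powR_gt0 p d0)) mulr1 mulr_sumr.
  apply: le_trans hz; apply: ler_sum => i _.
  by rewrite -powRM ?divr_ge0 ?(ltW d0)// mulrC divfK// gt_eqF.
have hx : \sum_i x i `^ p <= 1 by apply: normalize => // [i|]; [exact: nr_ge0|exact: hA].
have hy : \sum_i y i `^ p <= 1 by apply: normalize => // [i|]; [exact: nr_ge0|exact: hB].
pose s := a / (a + b).
have s0 : 0 <= s by rewrite divr_ge0 ?ltW.
have s1 : 0 <= 1 - s.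
  by rewrite subr_ge0 ler_pdivrMr// mul1r lerDl ltW.
have term i : nr (inner (f i) ((A \+ B) (e i))) `^ p <=
    (a + b) `^ p * (s * x i `^ p + (1 - s) * y i `^ p).
  pose z := s * x i + (1 - s) * y i.
  have z0 : 0 <= z by rewrite addr_ge0// mulr_ge0.
  apply: (@le_trans _ _ (((a + b) * z) `^ p)).
    apply: ge0_ler_powR => //; rewrite ?nnegrE ?nr_ge0 ?mulr_ge0 ?(ltW ab0)//.
    have -> : (a + b) * z = nr (inner (f i) (A (e i))) + nr (inner (f i) (B (e i))).
      by rewrite /z /s /x /y; field; rewrite !gt_eqF.
    by rewrite innerDr ler_nrD.
  rewrite powRM ?(ltW ab0)// ler_wpM2l ?powR_ge0//.
  have := ler_wpM2l s0 (powR_tangent p1 z0 (x0 i)).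
  have := ler_wpM2l s1 (powR_tangent p1 z0 (y0 i)).
  set w := p * _ => h1 h2; apply: le_trans (lerD h2 h1).
  have -> : s * (z `^ p + w * (x i - z)) + (1 - s) * (z `^ p + w * (y i - z)) =
      z `^ p + w * ((s * x i + (1 - s) * y i) - z) by ring.
  by rewrite -/z subrr mulr0 addr0.
apply: (le_trans (ler_sum _ (fun i _ => term i))).
rewrite -mulr_sumr ler_piMr ?powR_ge0// big_split/= -!mulr_sumr.
have := ler_wpM2l s0 hx; have := ler_wpM2l s1 hy; lra.
Qed.

(** The scaled coefficients [x] and [y] lie in [[0, 1]] and have square sums at most 1, so
    [(x y)^p <= x y <= (x^2 + y^2) / 2]. *)
Lemma pairing_bound_rank1 p a b u v : 1 <= p -> 0 < a -> 0 < b ->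
  nr u <= a -> nr v <= b ->
  pairing_bound p ((a * b) `^ p) (fun h => inner v h *: u).
Proof.
move=> p1 a0 b0 ua vb I e f be bf.
have p0 : 0 < p by apply: lt_le_trans p1.
pose x i := nr (inner (f i) u) / a.
pose y i := nr (inner (e i) v) / b.
have x0 i : 0 <= x i by rewrite divr_ge0 ?nr_ge0 ?ltW.
have y0 i : 0 <= y i by rewrite divr_ge0 ?nr_ge0 ?ltW.
have normalize (d : R) (g : I -> H) w : 0 < d -> bessel g -> nr w <= d ->
    \sum_i (nr (inner (g i) w) / d) ^+ 2 <= 1.
  move=> d0 bg wd; under eq_bigr do rewrite exprMn.
  rewrite -mulr_suml exprVn ler_pdivrMr ?exprn_gt0// mul1r.
  by rewrite (le_trans (bg w))// lerXn2r ?nnegrE ?nr_ge0 ?(ltW d0).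
have hx : \sum_i x i ^+ 2 <= 1 by exact: normalize.
have hy : \sum_i y i ^+ 2 <= 1 by exact: normalize.
have le1 (z : I -> R) i : (forall i, 0 <= z i) -> \sum_i z i ^+ 2 <= 1 -> z i <= 1.
  move=> z0 hz; rewrite -(@ler_pXn2r _ 2)// ?nnegrE// expr1n.
  by apply: le_trans hz; rewrite (bigD1 i)//= lerDl sumr_ge0// => j _; rewrite sqr_ge0.
have term i : nr (inner (f i) (inner v (e i) *: u)) `^ p <=
    (a * b) `^ p * (2^-1 * (x i ^+ 2 + y i ^+ 2)).
  have -> : nr (inner (f i) (inner v (e i) *: u)) = (a * b) * (x i * y i).
    rewrite innerZr nrM (nr_innerC v) /x /y; field; rewrite !gt_eqF//.
  have z0 : 0 <= x i * y i by rewrite mulr_ge0.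
  have ab0 : 0 <= a * b by rewrite mulr_ge0 ?ltW.
  rewrite (powRM _ ab0 z0) ler_wpM2l ?powR_ge0//.
  have z1 : x i * y i <= 1 by rewrite mulr_ile1// le1.
  apply: (@le_trans _ _ (x i * y i)).
    move: z0; rewrite le_eqVlt => /predU1P[<-|z0]; first by rewrite powR0// gt_eqF.
    by rewrite ge1r_powR// z0.
  have := sqr_ge0 (x i - y i); rewrite sqrrB; lra.
apply: (le_trans (ler_sum _ (fun i _ => term i))).
rewrite -mulr_sumr ler_piMr ?powR_ge0// -mulr_sumr big_split/=; lra.
Qed.

Lemma pairing_bound0 p c : 1 <= p -> 0 <= c -> pairing_bound p c (fun=> 0 : H).
Proof.
move=> p1 c0 I e f be bf; rewrite big1// => i _.
by rewrite inner0r nr0 powR0// gt_eqF// (lt_le_trans _ p1).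
Qed.

(** The successor leaves a positive constant for the empty sum, as [pairing_boundD] demands. *)
Lemma pairing_bound_sum p a (J : Type) (s : seq J) (F : J -> H -> H) :
  1 <= p -> 0 < a -> (forall j, pairing_bound p (a `^ p) (F j)) ->
  pairing_bound p (((size s).+1%:R * a) `^ p) (fun h => \sum_(j <- s) F j h).
Proof.
move=> p1 a0 hF; elim: s => [|j s ih].
  have -> : (fun h => \sum_(j <- [::]) F j h) = (fun=> 0).
    by apply/funext => h; rewrite big_nil.
  exact/pairing_bound0/powR_ge0.
have -> : (fun h => \sum_(k <- j :: s) F k h) =
    F j \+ (fun h => \sum_(k <- s) F k h).
  by apply/funext => h; rewrite big_cons.
rewrite -natr1 mulrDl mul1r addrC; apply: pairing_boundD => //.
by rewrite mulr_gt0.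
Qed.

Definition ores (J : finType) (v : J -> H) h := h - oproj v h.

Lemma ores_linear (J : finType) (v : J -> H) : linear (ores v).
Proof.
by move=> a u w; rewrite /ores (oproj_linear v) opprD addrACA scalerBr.
Qed.

Lemma ores_self_adjoint (J : finType) (v : J -> H) u w :
  inner (ores v u) w = inner u (ores v w).
Proof. by rewrite innerBl innerBr oproj_self_adjoint. Qed.

Lemma pythagoras (J : finType) (v : J -> H) h : orthofam v ->
  nr h ^+ 2 = nr (oproj v h) ^+ 2 + nr (ores v h) ^+ 2.
Proof. by move=> ov; rewrite nr_sqr_residual// nr_sqr_oproj// addrC subrK. Qed.

(** The [e i] only see the component of [h] in the span of [g], the [ores g (e' j)] only the one in
    the complement; Pythagoras adds the two Bessel inequalities. *)
Lemma bessel_union I (J K : finType) (g : K -> H) (e : I -> H) (e' : J -> H) :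
  orthofam g -> (forall i, oproj g (e i) = e i) -> bessel e -> bessel e' ->
  bessel (fun k : I + J =>
    match k with inl i => e i | inr j => ores g (e' j) end).
Proof.
move=> og ge be be' h; rewrite big_sumType/= (pythagoras h og) lerD//.
  apply: le_trans (be _); apply: ler_sum => i _.
  by rewrite -oproj_self_adjoint ge.
by apply: le_trans (be' _); apply: ler_sum => i _; rewrite ores_self_adjoint.
Qed.

(** Once [e] and [f] are extended by vectors of the complements, the total is still at most [c], and
    [e], [f] alone take [c0] of it. *)
Lemma pairing_bound_compress p c c0 A I (J K : finType) (e f : I -> H)
    (g : J -> H) (l : K -> H) :
  orthofam g -> orthofam l -> (forall i, oproj g (e i) = e i) ->
  (forall i, oproj l (f i) = f i) -> bessel e -> bessel f ->
  pairing_bound p c A -> c0 <= \sum_i nr (inner (f i) (A (e i))) `^ p ->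
  pairing_bound p (c - c0) (ores l \o A \o ores g).
Proof.
move=> og ol ge lf be bf hA hc I' e' f' be' bf'.
have := hA _ _ _ (bessel_union og ge be be') (bessel_union ol lf bf bf').
rewrite big_sumType/=.
under [X in _ + X]eq_bigr do rewrite ores_self_adjoint.
by rewrite /comp; lra.
Qed.

(* With [D = C - A] and [P], [Q] the projections on the spans and on their
   complements, [D = P_l D + Q_l D P_g + Q_l C Q_g - Q_l A Q_g]. The first two
   terms have small coefficients and fixed rank; the pairings of the last two
   are bounded by what [x] and [y] leave over from the bounds on [C] and [A]. *)
Lemma pairing_bound_near p c0 e d A C I (J K : finType) (x y : I -> H)
    (g : J -> H) (l : K -> H) (eta : R) :
  1 <= p -> 0 < d -> 0 < eta -> bounded_op A -> bounded_op C ->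
  orthofam g -> orthofam l -> (forall i, oproj g (x i) = x i) ->
  (forall i, oproj l (y i) = y i) -> bessel x -> bessel y ->
  2 * e <= d `^ p -> 0 <= e ->
  (#|J|.+1 + #|K|.+1)%:R * eta <= d ->
  pairing_bound p c0 A -> pairing_bound p (c0 + e) C ->
  c0 - e <= \sum_i nr (inner (y i) (A (x i))) `^ p ->
  c0 - e <= \sum_i nr (inner (y i) (C (x i))) `^ p ->
  (forall j, nr ((C \- A) (g j)) <= eta) ->
  (forall k, nr (adjoint (C \- A) (l k)) <= eta) ->
  pairing_bound p ((3 * d) `^ p) (C \- A).
Proof.
move=> p1 d0 eta0 bA bC og ol gx ly bx by_ ed e0 small hA hC sA sC nearg nearl.
have p0 : 0 <= p by apply: le_trans p1.
have bD := bounded_opB bC bA; set D := C \- A in bD nearg nearl *.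
have lD := bounded_op_lin bD.
(* [e] is lost twice here, in the bound on [C] and in the pairing of [x] and [y], but only once for
   [A]; hence the hypothesis on [2 * e]. *)
have qC : pairing_bound p (d `^ p) (ores l \o C \o ores g).
  apply: pairing_bound_le (pairing_bound_compress og ol gx ly bx by_ hC sC).
  by lra.
have qA : pairing_bound p (d `^ p) (\- (ores l \o A \o ores g)).
  apply/pairing_boundN.
  apply: pairing_bound_le (pairing_bound_compress og ol gx ly bx by_ hA sA).
  by lra.
(* The rank-one terms of [P_l D] involve [adjoint D (l k)]: this is where closeness of the adjoints
   enters. *)
have r1 : pairing_bound p ((#|K|.+1%:R * eta) `^ p) (fun h => oproj l (D h)).
  have -> : (fun h => oproj l (D h)) =
      (fun h => \sum_(k <- enum K) inner (adjoint D (l k)) h *: l k).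
    apply/funext => h; rewrite /oproj big_enum/=; apply: eq_bigr => k _.
    by rewrite inner_adjoint.
  rewrite cardE; apply: (@pairing_bound_sum p eta _ _
    (fun k h => inner (adjoint D (l k)) h *: l k)) => // k.
  by rewrite -(mul1r eta); apply: pairing_bound_rank1 => //; rewrite orthofam_nr.
have r2 : pairing_bound p ((#|J|.+1%:R * eta) `^ p) (fun h => ores l (D (oproj g h))).
  have -> : (fun h => ores l (D (oproj g h))) =
      (fun h => \sum_(j <- enum J) inner (g j) h *: ores l (D (g j))).
    apply/funext => h; rewrite big_enum/= {1}/oproj linear_fun_sum//.
    rewrite linear_fun_sum; last exact: ores_linear.
    apply: eq_bigr => j _.
    by rewrite linear_funZ// (linear_funZ _ _ (ores_linear l)).
  rewrite cardE; apply: (@pairing_bound_sum p eta _ _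
    (fun j h => inner (g j) h *: ores l (D (g j)))) => // j.
  rewrite -(mulr1 eta); apply: pairing_bound_rank1 => //; last by rewrite orthofam_nr.
  apply: le_trans (nearg j); rewrite -(@ler_pXn2r _ 2)// ?nnegrE ?nr_ge0//.
  by rewrite [leRHS](pythagoras _ ol) lerDr sqr_ge0.
have -> : D = ((fun h => oproj l (D h)) \+ (fun h => ores l (D (oproj g h)))) \+
   ((ores l \o C \o ores g) \+ (\- (ores l \o A \o ores g))).
  apply/funext => h /=.
  rewrite -(linear_funB _ _ (ores_linear l)) -[C _ - A _]/(D _) -addrA.
  rewrite -(linear_funD _ _ (ores_linear l)) -(linear_funD _ _ lD).
  by rewrite [oproj g h + _]addrC subrK addrC subrK.
have K0 : 0 < #|K|.+1%:R * eta by rewrite mulr_gt0.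
have J0 : 0 < #|J|.+1%:R * eta by rewrite mulr_gt0.
(* The two finite-rank terms share one [d], the two compressions take one each. *)
apply: (@pairing_bound_le _ (((#|K|.+1%:R * eta + #|J|.+1%:R * eta) + (d + d)) `^ p)).
  apply: ge0_ler_powR => //; rewrite ?nnegrE.
  - by rewrite !addr_ge0// ltW.
  - by rewrite mulr_ge0 ?(ltW d0).
  - by move: small; rewrite natrD mulrDl; lra.
by apply: pairing_boundD; rewrite ?addr_gt0//; apply: pairing_boundD.
Qed.

End schatten_norms.

(** * Continuous families of operators: the two implications *)

Section strong_continuity.
Context {X : topologicalType} {R : realType} {H : hilbertType R}.
Implicit Types (T : X -> H -> H) (p : R).

Lemma continuous_near (f : X -> H) x (e : R) : continuous f -> 0 < e ->
  \forall y \near x, nr (f y - f x) <= e.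
Proof.
move=> fc e0; have /cvgrPdist_le/(_ e%:C) := fc x.
rewrite ltcR => /(_ e0); apply: filterS => y.
by rewrite nrE lecR nr_distC.
Qed.

Lemma schatten_norm_ge0 p (A : H -> H) : (0 <= schatten_norm p A)%E.
Proof. exact: poweR_ge0. Qed.

Lemma schatten_norm_cvg0P p (F : X -> H -> H) (x : X) :
  (schatten_norm p (F y) @[y --> x] --> 0%E) <->
  forall e : R, 0 < e -> \forall y \near x, (schatten_norm p (F y) <= e%:E)%E.
Proof.
split=> [/fine_cvgP[fin] /cvgrPdist_le fc e e0|h].
  near=> y; have fy : schatten_norm p (F y) \is a fin_num by near: y.
  rewrite -(fineK fy) lee_fin; apply: le_trans (ler_norm _) _.
  by rewrite -normrN -[- _]add0r; near: y; exact: fc.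
apply/fine_cvgP; split.
  apply: filterS (h 1 ltr01) => y hy; rewrite ge0_fin_numE ?schatten_norm_ge0//.
  by rewrite (le_lt_trans hy) ?ltry.
apply/cvgrPdist_le => e e0; apply: filterS (h e e0) => y hy /=.
rewrite sub0r normrN ger0_norm ?fine_ge0 ?schatten_norm_ge0//.
rewrite -lee_fin fineK//= ge0_fin_numE ?schatten_norm_ge0//.
by rewrite (le_lt_trans hy) ?ltry.
Unshelve. all: by end_near. Qed.

Lemma schatten_norm_fine p (A : H -> H) : 1 <= p -> (trace_abs_pow p A < +oo)%E ->
  bounded_op A -> schatten_norm p A = (fine (trace_abs_pow p A) `^ p^-1)%:E.
Proof.
move=> p1 fA bA; rewrite -poweR_EFin fineK//.
by rewrite ge0_fin_numE// trace_abs_pow_ge0.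
Qed.

(** This makes vanishing at infinity the same condition on both sides: level [e] of the trace is
    level [e ^ (1 / p)] of the norm. *)
Lemma superlevel_schatten_norm p T : 1 <= p -> (forall x, schatten_class p (T x)) ->
  forall e : R, 0 < e ->
  [set x | e <= `|fine (trace_abs_pow p (T x))|] =
  [set x | ((e `^ p^-1)%:E <= schatten_norm p (T x))%E].
Proof.
move=> p1 cT e e0; apply/seteqP; split=> x /=; have [bT fT] := cT x;
  have t0 := fine_ge0 (trace_abs_pow_ge0 p1 bT);
  have p0 : 0 < p by apply: lt_le_trans p1.
- rewrite schatten_norm_fine// lee_fin ger0_norm// => h.
  by apply: ge0_ler_powR; rewrite ?invr_ge0 ?nnegrE ?(ltW p0) ?(ltW e0).
- rewrite schatten_norm_fine// lee_fin ger0_norm// => h.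
  rewrite -[e]powRr1 ?(ltW e0)// -[fine _]powRr1// -(mulVf (lt0r_neq0 p0)) !powRrM.
  by apply: ge0_ler_powR; rewrite ?nnegrE ?powR_ge0 ?(ltW p0).
Qed.

Lemma schatten_norm_pairing p (A : H -> H) (e : R) : 1 <= p ->
  schatten_class p A -> 0 <= e ->
  pairing_bound p ((fine (schatten_norm p A) + e) `^ p) A.
Proof.
move=> p1 [bA fA] e0; apply/(schatten_norm_leP p1 bA).
  by rewrite addr_ge0// fine_ge0// schatten_norm_ge0.
have fn : schatten_norm p A \is a fin_num by rewrite schatten_norm_fine.
by rewrite EFinD fineK// leeDl.
Qed.

(** One [e] is the distance itself; the other keeps the constant for [B] positive, as
    [pairing_boundD] demands, even if [B] has norm 0. *)
Lemma schatten_norm_dist p (A B : H -> H) (e : R) : 1 <= p ->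
  schatten_class p A -> schatten_class p B -> 0 < e ->
  pairing_bound p (e `^ p) (A \- B) ->
  fine (schatten_norm p A) <= fine (schatten_norm p B) + 2 * e.
Proof.
move=> p1 cA cB e0 hAB; have [bA fA] := cA.
have fn : schatten_norm p A \is a fin_num by rewrite schatten_norm_fine.
have n0 : 0 <= fine (schatten_norm p B) by rewrite fine_ge0// schatten_norm_ge0.
rewrite -lee_fin fineK//; apply/(schatten_norm_leP p1 bA).
  by rewrite addr_ge0// mulr_ge0// ltW.
have -> : A = B \+ (A \- B) by apply/funext => h /=; rewrite addrC subrK.
have -> : fine (schatten_norm p B) + 2 * e = (fine (schatten_norm p B) + e) + e by ring.
apply: pairing_boundD => //; first by rewrite ltr_wpDl.
by apply: schatten_norm_pairing => //; exact: ltW.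
Qed.

Lemma C0_schatten_continuous p T : 1 <= p -> (forall x, bounded_op (T x)) ->
  C0_schatten p T -> continuous (fun x => fine (trace_abs_pow p (T x)) : R).
Proof.
move=> p1 bT [cT nT _].
have p0 : 0 < p by apply: lt_le_trans p1.
have trE y : fine (trace_abs_pow p (T y)) = fine (schatten_norm p (T y)) `^ p.
  have [by_ fy] := cT y.
  rewrite schatten_norm_fine//= -powRrM mulVf ?gt_eqF// powRr1//.
  by rewrite fine_ge0// trace_abs_pow_ge0.
have n0 y : 0 <= fine (schatten_norm p (T y)).
  by rewrite fine_ge0// schatten_norm_ge0.
rewrite (funext trE) => x; apply/cvgrPdist_le => e e0.
have [d d0 hd] := powR_continuity p1 (n0 x) e0.
have d20 : 0 < d / 2 by rewrite divr_gt0.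
have dE : 2 * (d / 2) = d by rewrite mulrC divfK.
have /schatten_norm_cvg0P/(_ _ d20) := nT x; apply: filterS => y hy.
have bD := bounded_opB (bT y) (bT x).
have hD := (schatten_norm_leP p1 bD (ltW d20)).1 hy.
have := schatten_norm_dist p1 (cT y) (cT x) d20 hD.
have hD' : pairing_bound p ((d / 2) `^ p) (T x \- T y).
  have -> : T x \- T y = \- (T y \- T x) by apply/funext => h /=; rewrite opprB.
  exact: pairing_boundN.
have := schatten_norm_dist p1 (cT x) (cT y) d20 hD'.
by rewrite dE => h1 h2; exact: hd (n0 y) h1 h2.
Qed.

(* Gruemm's theorem, for an arbitrary net *)
Lemma schatten_C0_cvg p T : 1 <= p -> Cb_str T ->
  (forall x, (trace_abs_pow p (T x) < +oo)%E) ->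
  continuous (fun x => fine (trace_abs_pow p (T x)) : R) ->
  forall x : X, schatten_norm p (T y \- T x) @[y --> x] --> 0%E.
Proof.
move=> p1 [bT _ sT aT] fT tc x; apply/schatten_norm_cvg0P => r r0.
have p0 : 0 < p by apply: lt_le_trans p1.
have tE y : trace_abs_pow p (T y) = (fine (trace_abs_pow p (T y)))%:E.
  by rewrite fineK// ge0_fin_numE// trace_abs_pow_ge0.
pose c0 := fine (trace_abs_pow p (T x)).
(* Constants dictated by [pairing_bound_near]: its conclusion has [(3 * d) ^ p], and it asks for
   [2 * e <= d ^ p]. *)
pose d := r / 3.
have d0 : 0 < d by rewrite divr_gt0.
pose e := d `^ p / 2.
have e0 : 0 < e by rewrite divr_gt0// powR_gt0.
have ed : 2 * e <= d `^ p by rewrite mulrC divfK.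
have hA : pairing_bound p c0 (T x) by apply: pairing_bound_of_trace => //; rewrite tE.
(* Otherwise [c0 - e] would bound all pairings, hence the trace, which is [c0]. *)
have [I [u [v [bu [bv hs]]]]] : exists (I : finType) (u v : I -> H),
    bessel u /\ bessel v /\ c0 - e < \sum_i nr (inner (v i) (T x (u i))) `^ p.
  apply: contrapT => nex.
  have : (trace_abs_pow p (T x) <= (c0 - e)%:E)%E.
    apply: trace_of_pairing_bound => // I u v bu bv.
    by rewrite leNgt; apply/negP => lt; apply: nex; exists I, u, v.
  by rewrite tE lee_fin -/c0; lra.
(* A margin [b] for each single pairing: the lower bound [c0 - e] survives at [y] when every pairing
   moves by at most [b]. *)
have [b b0 hb] : exists2 b : R, 0 < b &
    c0 - e < \sum_i Num.max (nr (inner (v i) (T x (u i))) - b) 0 `^ p.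
  apply: contrapT => nex; move: hs; rewrite ltNge => /negP; apply.
  apply: le_sum_powR_limit => // [i|b b0]; first exact: nr_ge0.
  by rewrite leNgt; apply/negP => lt; apply: nex; exists b.
have [m [g [og hg]]] := gram_schmidt [seq u i | i : I].
have [n [l [ol hl]]] := gram_schmidt [seq v i | i : I].
have gu i : oproj g (u i) = u i by apply/hg/map_f; rewrite mem_enum.
have lv i : oproj l (v i) = v i by apply/hl/map_f; rewrite mem_enum.
pose N : R := (#|'I_m|.+1 + #|'I_n|.+1)%:R.
have N0 : 0 < N by rewrite ltr0n.
pose eta := d / N.
have eta0 : 0 < eta by rewrite divr_gt0.
near=> y.
have bD := bounded_opB (bT y) (bT x).
apply/(schatten_norm_leP p1 bD (ltW r0)).
have -> : r = 3 * d by rewrite mulrC divfK.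
apply: (@pairing_bound_near _ _ p c0 e d (T x) (T y) I _ _ u v g l eta) => //.
- exact: ltW.
- by rewrite -/N mulrC divfK// gt_eqF.
- apply: pairing_bound_of_trace => //; rewrite tE lee_fin -lerBlDl.
  apply: le_trans (ler_norm _) _; rewrite distrC.
  by near: y; have /cvgrPdist_le/(_ e e0) := tc x.
- exact: ltW.
- apply: (le_trans (ltW hb)); apply: ler_sum => i _.
  apply: ge0_ler_powR; rewrite ?nnegrE ?le_max ?lexx ?orbT ?nr_ge0 ?(ltW p0)//.
  rewrite ge_max nr_ge0 andbT lerBlDr.
  rewrite -[T x (u i)](subrK (T y (u i))) innerDr (le_trans (ler_nrD _ _))// addrC.
  rewrite lerD2l (le_trans (cauchy_schwarz _ _))//.
  apply: (@le_trans _ _ (nr (T x (u i) - T y (u i)))).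
    by rewrite ler_piMl ?nr_ge0// bessel_nr_le1.
  rewrite nr_distC; move: i; near: y.
  by apply: filter_forall => i; exact: continuous_near.
- move=> j /=; move: j; near: y.
  by apply: filter_forall => j; exact: continuous_near.
- move=> k; rewrite adjointB//=; move: k; near: y.
  by apply: filter_forall => k; exact: (continuous_near _ (aT _)).
Unshelve. all: by end_near. Qed.

End strong_continuity.

Theorem theorem3p18 (R : realType) (X : topologicalType) (H : hilbertType R)
    (p : R) (T : X -> H -> H)
    (hX : hausdorff_space X) (lcX : locally_compact [set: X])
    (sepH : separable H) (hp : 1 <= p) (hT : Cb_str T) :
  C0_schatten p T <-> schatten_C0 p T.
Proof.
have [bT _ _ _] := hT; have p0 : 0 < p by apply: lt_le_trans hp.
split=> [hC|[_ fT [tc cT]]].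
  have [cT _ kT] := hC; split=> //; first by move=> x; have [] := cT x.
  split; first exact: C0_schatten_continuous.
  move=> e e0; rewrite superlevel_schatten_norm//.
  by apply: kT; exact: powR_gt0.
have clT x : schatten_class p (T x) by split.
split=> //; first exact: schatten_C0_cvg.
(* Level [e ^ p] of the trace is level [e] of the norm. *)
move=> e e0; have := cT (e `^ p) (powR_gt0 _ e0).
rewrite superlevel_schatten_norm ?powR_gt0//.
by rewrite -powRrM divff ?gt_eqF// powRr1// ltW.
Qed.
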